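(* Cardinality-Constrained Cluster Deletion admits an algorithm running in time $2^{k}\cdot n^{\mathcal{O}(1)}$, where $n$ is the number of vertices of the input graph.
   Context: All graphs are finite and simple. A cluster graph is a graph in which every connected component is a clique. For integers $\gamma_1,\gamma_2\ge1$, a graph is $(\gamma_1,\gamma_2)$-cardinality-constrained if every connected component $H$ satisfies $\gamma_1\le|V(H)|\le\gamma_2$. Cardinality-Constrained Cluster Deletion: given a graph $G$ and non-negative integers $\gamma_1,\gamma_2,k$, decide whether there is $F\subseteq E(G)$ with $|F|\le k$ such that $(V(G),E(G)\setminus F)$ is a $(\gamma_1,\gamma_2)$-cardinality-constrained cluster graph. *)

(* Defs.v *)
From mathcomp Require Import all_boot.
Set Implicit Arguments.
Unset Strict Implicit.
Unset Printing Implicit Defensive.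

Record graph (V : finType) := Graph {
  edges : {set {set V}};
  card_edges : [forall e in edges, #|e| == 2]
}.

Section Graphs.
Variable V : finType.
Implicit Types (G : graph V) (F : {set {set V}}) (A : {set V}).

Definition adj G : rel V := fun u v => [set u; v] \in edges G.

Definition component G (x : V) : {set V} := [set y | connect (adj G) x y].

Definition components G : {set {set V}} := [set component G x | x : V].

Definition clique G A : bool :=
  [forall u in A, forall v in A, (u != v) ==> adj G u v].

Definition cluster_graph G : bool := [forall H in components G, clique G H].

Definition card_constrained (g1 g2 : nat) G : bool :=
  [forall H in components G, g1 <= #|H| <= g2].

Lemma del_edges_subproof G F : [forall e in edges G :\: F, #|e| == 2].
Proof.
apply/'forall_implyP => e; rewrite inE => /andP[_ eG].
by move/'forall_implyP: (card_edges G) => /(_ e eG).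
Qed.

Definition del_edges G F : graph V := Graph (del_edges_subproof G F).

Definition CCClusterDeletion G (g1 g2 k : nat) : bool :=
  [exists F : {set {set V}},
    [&& F \subset edges G, #|F| <= k,
        cluster_graph (del_edges G F)
      & card_constrained g1 g2 (del_edges G F)]].
End Graphs.

(* Random access machine with structured control flow.  There is no
   multiplication; the registers of the machine are the memory cells with
   constant addresses. Subtraction is truncated, so that comparisons are tests
   of differences against 0. *)
Inductive expr : Type :=
| Const of nat
| Deref of expr
| Add of expr & expr
| Sub of expr & expr.

Inductive cmd : Type :=
| Skip
| Store of expr & expr
| Seq of cmd & cmd
| If of expr & cmd & cmd
| While of expr & cmd.

Definition memory := nat -> nat.

Definition update (M : memory) (a v : nat) : memory :=
  fun b => if b == a then v else M b.

Fixpoint eval (M : memory) (e : expr) : nat :=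
  match e with
  | Const m => m
  | Deref a => M (eval M a)
  | Add a b => eval M a + eval M b
  | Sub a b => eval M a - eval M b
  end.

Fixpoint cost (e : expr) : nat :=
  match e with
  | Const _ => 1
  | Deref a => (cost a).+1
  | Add a b | Sub a b => (cost a + cost b).+1
  end.

(* No intermediate value overflows a machine word, the largest word being W. *)
Fixpoint fits (W : nat) (M : memory) (e : expr) : bool :=
  (eval M e <= W) &&
  match e with
  | Const _ => true
  | Deref a => fits W M a
  | Add a b | Sub a b => fits W M a && fits W M b
  end.

(* exec W c M t M': started in memory M, the program c halts in memory M' after
   exactly t steps, without overflow. A program that overflows is stuck, so the
   unit cost of arithmetic is only ever charged on words. *)
Inductive exec (W : nat) : cmd -> memory -> nat -> memory -> Prop :=
| ExecSkip M : exec W Skip M 1 M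
| ExecStore a e M : fits W M a -> fits W M e ->
    exec W (Store a e) M (cost a + cost e).+1 (update M (eval M a) (eval M e))
| ExecSeq c1 c2 M M1 M2 t1 t2 :
    exec W c1 M t1 M1 -> exec W c2 M1 t2 M2 -> exec W (Seq c1 c2) M (t1 + t2) M2
| ExecIfTrue e c1 c2 M M' t : fits W M e -> eval M e != 0 ->
    exec W c1 M t M' -> exec W (If e c1 c2) M (cost e + t).+1 M'
| ExecIfFalse e c1 c2 M M' t : fits W M e -> eval M e = 0 ->
    exec W c2 M t M' -> exec W (If e c1 c2) M (cost e + t).+1 M'
| ExecWhileFalse e c M : fits W M e -> eval M e = 0 ->
    exec W (While e c) M (cost e).+1 M
| ExecWhileTrue e c M M1 M2 t1 t2 : fits W M e -> eval M e != 0 ->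
    exec W c M t1 M1 -> exec W (While e c) M1 t2 M2 ->
    exec W (While e c) M (cost e + t1 + t2).+1 M2.

(* Cells 0 to 3 hold n, g1, g2 and k, the n ^ 2 cells from 4 on hold the
   adjacency matrix row by row, and all other cells hold 0. *)
Definition input (n : nat) (G : graph 'I_n) (g1 g2 k : nat) : memory :=
  fun a => match a with
  | 0 => n
  | 1 => g1
  | 2 => g2
  | 3 => k
  | i.+4 => [exists u : 'I_n, exists v : 'I_n, (i == u * n + v) && adj G u v]
  end.

(* The program leaves its answer in cell 0: 1 for yes, 0 for no. *)
Definition answers (P : cmd) (W T : nat) (M : memory) (b : bool) : Prop :=
  exists (t : nat) (M' : memory),
    [/\ exec W P M t M', t <= T & M' 0 = nat_of_bool b].

(* Main.v *)
Require Import Defs.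
From mathcomp Require Import all_boot.
From mathcomp Require Import zify.

Set Implicit Arguments.
Unset Strict Implicit.
Unset Printing Implicit Defensive.

(** An induced path u-v-w must lose uv or vw, and either choice spends one unit
    of the budget; hence the search tree has at most 2^k leaves, each a disjoint
    union of cliques. At a leaf the remaining cost is a sum over the cliques, and
    the cheapest way to split a clique of size s into parts of sizes in [g1, g2]
    depends on s only and is given by a knapsack recurrence. The leaves are
    enumerated by the numbers x < 2^k, whose binary digits are the successive
    choices.

    Solutions are handled as labellings f of the vertices (the label classes are
    the clusters), and costs count ordered pairs of separated adjacent vertices,
    i.e. twice the number of deleted edges.

    The machine program is compiled from a small language with separate variables
    and arrays and bounded loops only, whose programs are verified with a
    predicate transformer [wp]. *)

(** * A structured language over the machine *)

(** The machine has no stack on which to walk a search tree, so every leaf is recomputed from the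
    root out of its number x. This costs a polynomial factor per leaf and leaves only loops whose
    length is known on entry. The budget is not tested on the way either: a branch that runs out of
    digits goes on reading zeros, and only the total cost at the leaf is judged. Soundness thus
    holds for every x, since the deletions made so far together with an optimal splitting of the
    remaining cliques form an actual solution. For completeness a solution f is fixed. It separates
    one of the two edges of every induced path, and deleting that edge keeps all edges inside the
    clusters of f; hence at the leaf the clusters of f refine the cliques, and the splitting that f
    induces costs at least the knapsack optimum. *)

Inductive hexpr : Type :=
| HC of nat
| HV of nat
| HA of nat & hexpr
| HIn of hexpr
| HAdd of hexpr & hexpr
| HSub of hexpr & hexpr.

Inductive hcmd : Type :=
| HSkip
| HSet of nat & hexpr
| HSetA of nat & hexpr & hexpr
| HSeq of hcmd & hcmd
| HIf of hexpr & hcmd & hcmd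
(* [HFor b i x c] runs [c] for i = 0, ..., x - 1. The flag [b] only serves the time
   bound: it says whether x is at most 2^k or at most n + 1 (see [lim]). *)
| HFor of bool & nat & nat & hcmd.

Record state := State { vars : nat -> nat; arrs : nat -> nat -> nat }.

Definition setv i x s :=
  State (fun z => if z == i then x else vars s z) (arrs s).

Definition seta a i x s :=
  State (vars s)
    (fun b j => if (b == a) && (j == i) then x else arrs s b j).

(** Both constants are read off [solver]: 16 registers suffice for it, and 30 bounds the weight [wt]
    of its expressions. [solver_wf] checks this by computation. *)
Definition nreg := 16.
Definition maxwt := 30.

(** The factor is a constant of the program, so the missing multiplication can be unrolled into
    additions. *)
Definition mulE m e := iter m (Add e) (Const 0).
Definition sizeE := Deref (Const 0).
(* Register i lives in cell 4 + i(n+1). This is a diagonal entry of the adjacency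
   matrix or a cell beyond the matrix, so it holds 0 in the input and carries no
   information; unlike the cells beyond the matrix in general, it is addressable
   without knowing n^2. *)
Definition regE i := Add (Const (4 + i)) (mulE i sizeE).
(* Register 0 is reserved for n^2. *)
Definition capE := Add (Deref (regE 0)) (Add sizeE (Const 1)).
(** The factor [a.+1] skips one block of [cap] cells, which puts all arrays beyond the adjacency
    matrix for every n. *)
Definition arrE a e :=
  Add (Add (Const (4 + nreg)) (mulE nreg sizeE)) (Add (mulE a.+1 capE) e).

Fixpoint compile_expr (e : hexpr) : expr :=
  match e with
  | HC m => Const m
  | HV i => Deref (regE i)
  | HA a e => Deref (arrE a (compile_expr e))
  | HIn e => Deref (compile_expr e)
  | HAdd e1 e2 => Add (compile_expr e1) (compile_expr e2)
  | HSub e1 e2 => Defs.Sub (compile_expr e1) (compile_expr e2)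
  end.

Definition testE i x := Defs.Sub (Deref (regE x)) (Deref (regE i)).
Definition incC i := Store (regE i) (Add (Deref (regE i)) (Const 1)).

Fixpoint compile (c : hcmd) : cmd :=
  match c with
  | HSkip => Skip
  | HSet i e => Store (regE i) (compile_expr e)
  | HSetA a e1 e2 => Store (arrE a (compile_expr e1)) (compile_expr e2)
  | HSeq c1 c2 => Seq (compile c1) (compile c2)
  | HIf e c1 c2 => If (compile_expr e) (compile c1) (compile c2)
  | HFor _ i x c =>
      Seq (Store (regE i) (Const 0)) (While (testE i x) (Seq (compile c) (incC i)))
  end.

(* If all cells hold at most Y, then [e] evaluates to at most [wt e * Y.+1]. *)
Fixpoint wt (e : hexpr) : nat :=
  match e with
  | HC m => m.+1
  | HV _ => 1
  | HA _ e => (wt e).+1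
  | HIn e => (wt e).+1
  | HAdd e1 e2 | HSub e1 e2 => wt e1 + wt e2
  end.

Fixpoint wfe (e : hexpr) : bool :=
  match e with
  | HC m => true
  | HV i => i < nreg
  | HA a e => (a < 3) && wfe e
  | HIn e => wfe e
  | HAdd e1 e2 | HSub e1 e2 => wfe e1 && wfe e2
  end.

Definition wfex e := wfe e && (wt e <= maxwt).

Fixpoint writes (c : hcmd) : seq nat :=
  match c with
  | HSkip | HSetA _ _ _ => [::]
  | HSet i _ => [:: i]
  | HSeq c1 c2 | HIf _ c1 c2 => writes c1 ++ writes c2
  | HFor _ i _ c => i :: writes c
  end.

Fixpoint awrites (c : hcmd) : seq nat :=
  match c with
  | HSkip | HSet _ _ => [::]
  | HSetA a _ _ => [:: a]
  | HSeq c1 c2 | HIf _ c1 c2 => awrites c1 ++ awrites c2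
  | HFor _ _ _ c => awrites c
  end.

(** A loop body writes neither its counter nor its limit; this fixes the number of iterations on
    entry. *)
Fixpoint wfc (c : hcmd) : bool :=
  match c with
  | HSkip => true
  | HSet i e => (i < nreg) && wfex e
  | HSetA a e1 e2 => [&& a < 3, wfex e1 & wfex e2]
  | HSeq c1 c2 => wfc c1 && wfc c2
  | HIf e c1 c2 => [&& wfex e, wfc c1 & wfc c2]
  | HFor _ i x c =>
      [&& i < nreg, x < nreg, i != x, i \notin writes c, x \notin writes c & wfc c]
  end.

Definition headcost i x := cost (regE i) + cost (testE i x) + 3.
Definition itercost i x :=
  cost (testE i x) + cost (regE i) + cost (Add (Deref (regE i)) (Const 1)) + 2.

Fixpoint tconst (c : hcmd) : nat :=
  match c with
  | HSeq c1 c2 => tconst c1 + tconst c2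
  | HIf e c1 c2 => (cost (compile_expr e) + (tconst c1 + tconst c2)).+1
  | HFor b i x c => headcost i x + (itercost i x + tconst c)
  | HSkip => 1
  | HSet i e => (cost (regE i) + cost (compile_expr e)).+1
  | HSetA a e1 e2 => (cost (arrE a (compile_expr e1)) + cost (compile_expr e2)).+1
  end.

Fixpoint ndepth (c : hcmd) : nat :=
  match c with
  | HSeq c1 c2 | HIf _ c1 c2 => ndepth c1 + ndepth c2
  | HFor b _ _ c => ~~ b + ndepth c
  | _ => 0
  end.

(** A maximum, where [ndepth] is content with a sum: consecutive loops of length 2^k must not
    multiply, as the final bound admits only the first power of 2^k. *)
Fixpoint kdepth (c : hcmd) : nat :=
  match c with
  | HSeq c1 c2 | HIf _ c1 c2 => maxn (kdepth c1) (kdepth c2)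
  | HFor b _ _ c => b + kdepth c
  | _ => 0
  end.

(** * Running time of the structured language *)

Section Time.
Variables n k : nat.

Definition lim (b : bool) := if b then 2 ^ k else n.+1.

Fixpoint tbound (c : hcmd) : nat :=
  match c with
  | HSkip => 1
  | HSet i e => (cost (regE i) + cost (compile_expr e)).+1
  | HSetA a e1 e2 => (cost (arrE a (compile_expr e1)) + cost (compile_expr e2)).+1
  | HSeq c1 c2 => tbound c1 + tbound c2
  | HIf e c1 c2 => (cost (compile_expr e) + (tbound c1 + tbound c2)).+1
  | HFor b i x c => headcost i x + lim b * (itercost i x + tbound c)
  end.

Lemma tbound_poly c :
  tbound c <= tconst c * (n.+1 ^ ndepth c * (2 ^ k) ^ kdepth c).
Proof.
have n0 m : 0 < n.+1 ^ m by rewrite expn_gt0.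
have k0 m : 0 < (2 ^ k) ^ m by rewrite !expn_gt0.
have mono d1 d2 e1 e2 : d1 <= d2 -> e1 <= e2 ->
    n.+1 ^ d1 * (2 ^ k) ^ e1 <= n.+1 ^ d2 * (2 ^ k) ^ e2.
  by move=> *; rewrite leq_mul ?leq_pexp2l ?expn_gt0.
elim: c => //= [i e|a e1 e2|c1 IH1 c2 IH2|e c1 IH1 c2 IH2|b i x c IH].
- by rewrite !muln1.
- by rewrite !muln1.
- rewrite mulnDl leq_add //.
    by apply: leq_trans IH1 _; rewrite leq_mul ?mono ?leq_addr ?leq_maxl.
  by apply: leq_trans IH2 _; rewrite leq_mul ?mono ?leq_addl ?leq_maxr.
- rewrite -!addSn mulnDl leq_add //; first by rewrite leq_pmulr // muln_gt0 n0 k0.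
  rewrite mulnDl leq_add //.
    by apply: leq_trans IH1 _; rewrite leq_mul ?mono ?leq_addr ?leq_maxl.
  by apply: leq_trans IH2 _; rewrite leq_mul ?mono ?leq_addl ?leq_maxr.
have -> : n.+1 ^ (~~ b + ndepth c) * (2 ^ k) ^ (b + kdepth c) =
    lim b * (n.+1 ^ ndepth c * (2 ^ k) ^ kdepth c).
  by case: b => /=; rewrite ?add0n ?add1n ?expnS; lia.
have lim0 : 0 < lim b by case: (b); rewrite /lim ?expn_gt0.
set X := n.+1 ^ _ * _ in IH *; have X0 : 0 < X by rewrite muln_gt0 n0 k0.
rewrite mulnDl leq_add //; first by rewrite leq_pmulr // muln_gt0 lim0.
rewrite mulnCA leq_mul // mulnDl leq_add // leq_pmulr //.
Qed.
End Time.

(** * Predicate transformer and soundness of the compilation *)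

Section Machine.
Variables (n k Y W : nat) (inp : memory).

Local Notation lim := (lim n k).
Local Notation tbound := (tbound n k).

(** One length for all arrays: there is room for the n^2 entries of a matrix as well as for the n +
    1 entries of the knapsack table. *)
Definition cap := (n * n + n).+1.
(* The input cells that are not used as registers. *)
Definition inok a := a < 4 + n * n /\ forall i, i < nreg -> a <> 4 + i * n.+1.

Fixpoint ev (s : state) (e : hexpr) : nat :=
  match e with
  | HC m => m
  | HV i => vars s i
  | HA a e => arrs s a (ev s e)
  | HIn e => inp (ev s e)
  | HAdd e1 e2 => ev s e1 + ev s e2
  | HSub e1 e2 => ev s e1 - ev s e2
  end.

(** Array accesses ask for n^2 in register 0 because their addresses are computed from it through
    [capE]. *)
Fixpoint eok (s : state) (e : hexpr) : Prop :=
  match e with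
  | HC _ | HV _ => True
  | HA a e => eok s e /\ (ev s e < cap /\ vars s 0 = n * n)
  | HIn e => eok s e /\ inok (ev s e)
  | HAdd e1 e2 | HSub e1 e2 => eok s e1 /\ eok s e2
  end.

Fixpoint forwp (body : (state -> Prop) -> state -> Prop) i m j Q s : Prop :=
  if m is m'.+1 then body (forwp body i m' j.+1 Q) (setv i j s)
  else Q (setv i j s).

Fixpoint wp (c : hcmd) (Q : state -> Prop) (s : state) : Prop :=
  match c with
  | HSkip => Q s
  | HSet i e => [/\ eok s e, ev s e <= Y & Q (setv i (ev s e) s)]
  | HSetA a e1 e2 =>
      [/\ eok s e1, eok s e2, ev s e1 < cap /\ vars s 0 = n * n, ev s e2 <= Y
        & Q (seta a (ev s e1) (ev s e2) s)]
  | HSeq c1 c2 => wp c1 (wp c2 Q) s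
  | HIf e c1 c2 => eok s e /\ (if ev s e == 0 then wp c2 Q s else wp c1 Q s)
  | HFor b i x c => vars s x <= lim b /\ forwp (wp c) i (vars s x) 0 Q s
  end.

Lemma wp_mono c (Q Q' : state -> Prop) s :
  (forall s', Q s' -> Q' s') -> wp c Q s -> wp c Q' s.
Proof.
elim: c Q Q' s => [|i e|a e1 e2|c1 IH1 c2 IH2|e c1 IH1 c2 IH2|b i x c IH] Q Q' s QQ /=.
- exact: QQ.
- by case=> ? ? /QQ.
- by case=> ? ? ? ? /QQ.
- by apply: IH1 => s'; apply: IH2.
- by case=> ?; case: ifP => _ H; split=> //; [apply: IH2 H | apply: IH1 H].
case=> le_x H; split=> //.
move: (vars s x) 0 H {le_x} => m j; elim: m j s => [|m IHm] j s /=; first exact: QQ.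
by apply: IH => s'; apply: IHm.
Qed.

Definition same (ws aw : seq nat) (s s' : state) :=
  (forall z, z \notin ws -> vars s' z = vars s z) /\
  (forall a, a \notin aw -> arrs s' a =1 arrs s a).

Lemma same_trans ws aw ws1 aw1 ws2 aw2 s s1 s2 :
  {subset ws1 <= ws} -> {subset aw1 <= aw} -> {subset ws2 <= ws} ->
  {subset aw2 <= aw} -> same ws1 aw1 s s1 -> same ws2 aw2 s1 s2 -> same ws aw s s2.
Proof.
move=> w1 a1 w2 a2 [V1 A1] [V2 A2]; split=> [z nz|a na i].
  by rewrite V2 ?V1 //; apply: contra nz; [apply: w1 | apply: w2].
by rewrite A2 ?A1 //; apply: contra na; [apply: a1 | apply: a2].
Qed.

(** The syntactic write sets yield a frame condition for free, so specifications and loop invariants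
    need to mention only what changes. *)
Lemma wp_frame c Q s :
  wp c Q s -> wp c (fun s' => Q s' /\ same (writes c) (awrites c) s s') s.
Proof.
elim: c Q s => [|i e|a e1 e2|c1 IH1 c2 IH2|e c1 IH1 c2 IH2|b i x c IH] Q s /=.
- by split.
- by case=> ? ? ?; split=> //; split=> //; split=> // z; rewrite inE /= => /negPf->.
- case=> ? ? ? ? ?; split=> //; split=> //; split=> // b.
  by rewrite inE => /negPf nb j /=; rewrite nb.
- move=> H; apply: wp_mono (IH1 _ _ H) => s1 [/IH2 H2 S1].
  apply: wp_mono H2 => s2 [q S2]; split=> //.
  by apply: same_trans S1 S2 => z; rewrite mem_cat => ->; rewrite ?orbT.
- have id0 : same [::] [::] s s by [].
  case=> ok H; split=> //; case: ifP H => _ H.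
    apply: wp_mono (IH2 _ _ H) => s1 [q S1]; split=> //.
    by apply: same_trans id0 S1 => z; rewrite // mem_cat => ->; rewrite orbT.
  apply: wp_mono (IH1 _ _ H) => s1 [q S1]; split=> //.
  by apply: same_trans id0 S1 => z; rewrite // mem_cat => ->.
case=> le H; split=> //.
have setS s1 x' : same (i :: writes c) (awrites c) s s1 ->
    same (i :: writes c) (awrites c) s (setv i x' s1).
  case=> V1 A1; split=> // z nz; rewrite /= -V1 //.
  by move: nz; rewrite inE negb_or => /andP[/negPf->].
have loop m : forall j s1, same (i :: writes c) (awrites c) s s1 ->
    forwp (wp c) i m j Q s1 ->
    forwp (wp c) i m j (fun s' => Q s' /\ same (i :: writes c) (awrites c) s s') s1.
  elim: m => [|m IHm] j s1 S1 /=; first by split=> //; apply: setS.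
  move=> Hm; apply: wp_mono (IH _ _ Hm) => s2 [H2 S2]; apply: IHm => //.
  by apply: same_trans (setS _ j S1) S2 => z; rewrite // inE => ->; rewrite orbT.
exact: loop.
Qed.

Lemma wp_for b i x c (Inv : nat -> state -> Prop) (Q : state -> Prop) s :
  vars s x <= lim b -> Inv 0 s ->
  (forall j s', j < vars s x -> Inv j s' -> same (i :: writes c) (awrites c) s s' ->
    wp c (Inv j.+1) (setv i j s')) ->
  (forall s', Inv (vars s x) s' -> same (i :: writes c) (awrites c) s s' ->
    Q (setv i (vars s x) s')) ->
  wp (HFor b i x c) Q s.
Proof.
move=> le_x I0 IS IQ; split=> //.
have loop m : forall j s', m + j = vars s x -> Inv j s' ->
    same (i :: writes c) (awrites c) s s' -> forwp (wp c) i m j Q s'.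
  elim: m => [|m IHm] j s' /=; first by rewrite add0n => -> /IQ.
  move=> E Ij S1; have ltj : j < vars s x by rewrite -E; lia.
  apply: wp_mono (wp_frame (IS j s' ltj Ij S1)) => s2 [I2 [V2 A2]].
  apply: IHm; rewrite ?addnS // -?addSn //; split=> [z|a na]; last first.
    by move=> y; rewrite A2 // S1.2.
  move=> nz; rewrite -S1.1 //; move: nz; rewrite inE negb_or => /andP[nz1 nz2].
  by rewrite V2 //= (negPf nz1).
by apply: loop => //; rewrite addn0.
Qed.

Hypothesis inp0 : inp 0 = n.
Hypothesis inpY : forall a, inok a -> inp a <= Y.
Hypothesis W_val : maxwt * Y.+1 <= W.
Hypothesis W_adr : 4 + nreg * n.+1 + 4 * cap <= W.

Record rep (s : state) (M : memory) : Prop := Rep {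
  rep_in : forall a, inok a -> M a = inp a;
  rep_v : forall i, i < nreg -> M (4 + i * n.+1) = vars s i;
  rep_a : forall a i, a < 3 -> i < cap ->
            M (4 + nreg * n.+1 + a.+1 * cap + i) = arrs s a i;
  bnd_v : forall i, i < nreg -> vars s i <= Y;
  bnd_a : forall a i, a < 3 -> i < cap -> arrs s a i <= Y
}.

Lemma inok0 : inok 0.
Proof. by split=> // i _; rewrite addSn. Qed.

Lemma rep_size s M : rep s M -> M 0 = n.
Proof. by move=> r; rewrite (rep_in r inok0). Qed.


Definition yields M e x := fits W M e /\ eval M e = x.

Lemma yields_le M e x : yields M e x -> x <= W.
Proof. by case=> + <-; case: e => [?|?|? ?|? ?] /= /andP[]. Qed.

Lemma yields_const M m : m <= W -> yields M (Const m) m.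
Proof. by move=> le; split=> //=; rewrite le. Qed.

Lemma yields_deref M e x : yields M e x -> M x <= W -> yields M (Deref e) (M x).
Proof. by case=> f <- le; split=> //=; rewrite f le. Qed.

Lemma yields_add M e1 e2 x1 x2 :
  yields M e1 x1 -> yields M e2 x2 -> x1 + x2 <= W -> yields M (Add e1 e2) (x1 + x2).
Proof. by case=> f1 <- [f2 <-] le; split=> //=; rewrite f1 f2 le. Qed.

Lemma yields_sub M e1 e2 x1 x2 :
  yields M e1 x1 -> yields M e2 x2 -> yields M (Defs.Sub e1 e2) (x1 - x2).
Proof.
move=> y1; have := yields_le y1; case: y1 => f1 <- le1 [f2 <-].
by split=> //=; rewrite f1 f2 !andbT (leq_trans (leq_subr _ _)).
Qed.

Lemma yields_mul M m e x : yields M e x -> m * x <= W -> yields M (mulE m e) (m * x).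
Proof.
move=> ye; elim: m => [|m IH] le; first exact: yields_const.
rewrite mulSn; apply: yields_add => //; apply: IH.
by apply: leq_trans le; rewrite leq_mul2r leqnSn orbT.
Qed.

Lemma yields_size s M : rep s M -> yields M sizeE n.
Proof.
move=> r; rewrite -[X in yields _ _ X](rep_size r); apply: yields_deref; first exact: yields_const.
by rewrite (rep_size r); move: W_adr; rewrite /cap; lia.
Qed.

Lemma yields_reg s M i : rep s M -> i < nreg -> yields M (regE i) (4 + i * n.+1).
Proof.
move=> r lti; have le := leq_mul (ltnW lti) (leqnn n.+1).
have WA := W_adr; rewrite mulnS in le *; rewrite addnA.
by apply: yields_add; [apply: yields_const|apply: yields_mul (yields_size r) _|];
   lia.
Qed.

Lemma leYW x : x <= Y.+1 -> x <= W.
Proof. by move: W_val; rewrite /maxwt; lia. Qed.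

Lemma yields_var s M i : rep s M -> i < nreg -> yields M (Deref (regE i)) (vars s i).
Proof.
move=> r lti; rewrite -(rep_v r lti); apply: yields_deref (yields_reg r lti) _.
by rewrite (rep_v r lti) leYW // leqW // (bnd_v r).
Qed.

Lemma yields_arr s M a e x : rep s M -> a < 3 -> vars s 0 = n * n ->
  yields M e x -> x < cap ->
  yields M (arrE a e) (4 + nreg * n.+1 + a.+1 * cap + x).
Proof.
move=> r lta v0 ye ltx; have yn := yields_size r.
have y0 : yields M (Deref (regE 0)) (n * n) by rewrite -v0; apply: yields_var.
have lec : a.+1 * cap <= 3 * cap by rewrite leq_mul2r lta orbT.
have yc : yields M capE cap.
  rewrite /cap -addnS -addn1; move: W_adr; rewrite /cap => WA.
  by apply: yields_add y0 (yields_add yn _ _) _; rewrite ?addn1; try apply: yields_const; lia.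
have WA := W_adr.
have -> : 4 + nreg * n.+1 + a.+1 * cap + x = 4 + nreg + nreg * n + (a.+1 * cap + x).
  by rewrite mulnS; lia.
rewrite mulnS in WA; apply: yields_add; last by lia.
  by apply: yields_add; [apply: yields_const|apply: yields_mul yn _|]; lia.
by apply: yields_add ye _; [apply: yields_mul yc _|]; lia.
Qed.

Lemma ev_wt s M e : rep s M -> wfe e -> eok s e -> ev s e <= wt e * Y.+1.
Proof.
move=> r; elim: e => [m|i|a e IH|e IH|e1 IH1 e2 IH2|e1 IH1 e2 IH2] /=.
- by move=> _ _; rewrite mulSn mulnS; lia.
- by move=> lti _; rewrite mul1n leqW // (bnd_v r).
- by case/andP=> lta _ [_ [lt _]]; rewrite mulSn; have := bnd_a r lta lt; lia.
- by move=> _ [_ /inpY]; rewrite mulSn; lia.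
- by case/andP=> /IH1 H1 /IH2 H2 [/H1 ? /H2 ?]; rewrite mulnDl leq_add.
- by case/andP=> /IH1 H1 /IH2 H2 [/H1 ? /H2 ?]; rewrite mulnDl; lia.
Qed.

Lemma yields_compile s M e : rep s M -> wfex e -> eok s e -> yields M (compile_expr e) (ev s e).
Proof.
move=> r /andP[]; elim: e => [m|i|a e IH|e IH|e1 IH1 e2 IH2|e1 IH1 e2 IH2] /=.
- by move=> _ le _; apply: yields_const; move: W_val; have := leq_mul le (leqnn Y.+1); lia.
- by move=> lti _ _; apply: yields_var.
- case/andP=> lta wf le [ok [lt v0]]; rewrite -(rep_a r lta lt).
  apply: yields_deref; first by apply: (yields_arr r) => //; apply: IH => //; lia.
  by rewrite (rep_a r) // leYW // leqW // (bnd_a r).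
- move=> wf le [ok okin]; rewrite -(rep_in r okin).
  apply: yields_deref; first by apply: IH => //; lia.
  by rewrite (rep_in r) // leYW // leqW // inpY.
- case/andP=> wf1 wf2 le [ok1 ok2]; apply: yields_add.
  + by apply: IH1 => //; lia.
  + by apply: IH2 => //; lia.
  apply: leq_trans W_val; apply: leq_trans (leq_mul le (leqnn _)).
  by rewrite mulnDl leq_add // (ev_wt r).
- case/andP=> wf1 wf2 le [ok1 ok2]; apply: yields_sub.
  + by apply: IH1 => //; lia.
  + by apply: IH2 => //; lia.
Qed.

Lemma reg_inj i j : 4 + i * n.+1 = 4 + j * n.+1 -> i = j.
Proof. by move/addnI/eqP; rewrite eqn_pmul2r // => /eqP. Qed.

Lemma reg_lt i a x : i < nreg -> 4 + i * n.+1 < 4 + nreg * n.+1 + a.+1 * cap + x.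
Proof.
move=> lti; rewrite -!addnA ltn_add2l; apply: leq_trans (leq_addr _ _).
by rewrite ltn_pmul2r.
Qed.

Lemma inok_lt a b x : inok a -> a < 4 + nreg * n.+1 + b.+1 * cap + x.
Proof. by case=> lt _; rewrite mulSn {1}/cap; lia. Qed.

Lemma arr_inj a b i j : i < cap -> j < cap ->
  4 + nreg * n.+1 + a.+1 * cap + i = 4 + nreg * n.+1 + b.+1 * cap + j ->
  a = b /\ i = j.
Proof.
move=> lti ltj; rewrite -!addnA !mulSn => /addnI/addnI; rewrite -!addnA => /addnI E.
have Ea : a = b.
  by move: (congr1 (divn^~ cap) E); rewrite !divnMDl // !divn_small // !addn0.
by split=> //; move: E; rewrite Ea => /addnI.
Qed.

Lemma rep_setv s M i x : rep s M -> i < nreg -> x <= Y ->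
  rep (setv i x s) (update M (4 + i * n.+1) x).
Proof.
case=> Hin Hv Ha bv ba lti leY; split; rewrite /update /=.
- move=> a oka; case: eqP => [E|_]; last exact: Hin.
  by case: oka => _ /(_ i lti).
- move=> j ltj; case: eqP => [/reg_inj ->|ne]; first by rewrite eqxx.
  by case: eqP => [E|_]; [rewrite E in ne | apply: Hv].
- move=> a j lta ltj; case: eqP => [E|_]; last exact: Ha.
  by have := @reg_lt i a j lti; rewrite E ltnn.
- by move=> j ltj; case: eqP => // _; apply: bv.
- exact: ba.
Qed.

Lemma rep_seta s M a i x : rep s M -> a < 3 -> i < cap -> x <= Y ->
  rep (seta a i x s) (update M (4 + nreg * n.+1 + a.+1 * cap + i) x).
Proof.
case=> Hin Hv Ha bv ba lta lti leY; split; rewrite /update /=.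
- move=> b okb; case: eqP => [E|_]; last exact: Hin.
  by have := inok_lt a i okb; rewrite E ltnn.
- move=> j ltj; case: eqP => [E|_]; last exact: Hv.
  by have := @reg_lt j a i ltj; rewrite E ltnn.
- move=> b j ltb ltj; case: eqP => [/arr_inj[] // -> ->|ne]; first by rewrite !eqxx.
  by case: andP => [[/eqP E1 /eqP E2]|_]; [rewrite E1 E2 in ne | apply: Ha].
- exact: bv.
- by move=> b j ltb ltj; case: andP => // _; apply: ba.
Qed.

Lemma exec_store M a e x y : yields M a x -> yields M e y ->
  exec W (Store a e) M (cost a + cost e).+1 (update M x y).
Proof. by case=> fa <- [fe <-]; apply: ExecStore. Qed.

Lemma compile_sound c Q s M : wfc c -> wp c Q s -> rep s M ->
  exists t M' s', [/\ exec W (compile c) M t M', t <= tbound c, rep s' M',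
    (forall z, z \notin writes c -> vars s' z = vars s z) & Q s'].
Proof.
elim: c Q s M => [|i e|a e1 e2|c1 IH1 c2 IH2|e c1 IH1 c2 IH2|b i x c IH] Q s M.
- by move=> _ q r; exists 1, M, s; split=> //; apply: ExecSkip.
- case/andP=> lti wf [ok le q] r.
  have X := exec_store (yields_reg r lti) (yields_compile r wf ok).
  exists (cost (regE i) + cost (compile_expr e)).+1,
    (update M (4 + i * n.+1) (ev s e)), (setv i (ev s e) s); split.
  + exact: X.
  + by [].
  + exact: rep_setv.
  + by move=> z; rewrite inE /= => /negPf->.
  + by [].
- case/and3P=> lta wf1 wf2 [ok1 ok2 [lt v0] le q] r.
  have yi := yields_arr r lta v0 (yields_compile r wf1 ok1) lt.
  have X := exec_store yi (yields_compile r wf2 ok2).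
  exists (cost (arrE a (compile_expr e1)) + cost (compile_expr e2)).+1,
    (update M (4 + nreg * n.+1 + a.+1 * cap + ev s e1) (ev s e2)),
    (seta a (ev s e1) (ev s e2) s); split.
  + exact: X.
  + by [].
  + exact: rep_seta.
  + by [].
  + by [].
- case/andP=> wf1 wf2 /= q r.
  have [t1 [M1 [s1 [x1 l1 r1 f1 q1]]]] := IH1 _ _ _ wf1 q r.
  have [t2 [M2 [s2 [x2 l2 r2 f2 q2]]]] := IH2 _ _ _ wf2 q1 r1.
  exists (t1 + t2), M2, s2; split=> //; first exact: ExecSeq x1 x2.
    exact: leq_add.
  by move=> z; rewrite mem_cat negb_or => /andP[/f1 <- /f2 <-].
- case/and3P=> wfe wf1 wf2 [ok q] r; have [fe ee] := yields_compile r wfe ok.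
  case: eqP q => [e0|/eqP ne0] q.
    have [t [M' [s' [xx l r' f q']]]] := IH2 _ _ _ wf2 q r.
    exists (cost (compile_expr e) + t).+1, M', s'; split=> //=.
    + by apply: ExecIfFalse; rewrite ?ee.
    + by lia.
    + by move=> z; rewrite mem_cat negb_or => /andP[_ /f].
  have [t [M' [s' [xx l r' f q']]]] := IH1 _ _ _ wf1 q r.
  exists (cost (compile_expr e) + t).+1, M', s'; split=> //=.
  + by apply: ExecIfTrue; rewrite ?ee.
  + by lia.
  + by move=> z; rewrite mem_cat negb_or => /andP[/f].
case/and5P=> lti ltx neix niw /andP[nxw wf] [lex q] r.
have nxi : (x == i) = false by rewrite eq_sym; apply: negPf.
set Wh := While (testE i x) (Seq (compile c) (incC i)).
have loop m j s1 M1 : j + m = vars s x -> vars s1 x = vars s x ->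
    (forall z, z \notin i :: writes c -> vars s1 z = vars s z) ->
    forwp (wp c) i m j Q s1 -> rep (setv i j s1) M1 ->
  exists t M' s', [/\ exec W Wh M1 t M',
    t <= (cost (testE i x)).+1 + m * (itercost i x + tbound c), rep s' M',
    (forall z, z \notin i :: writes c -> vars s' z = vars s z) & Q s'].
  elim: m j s1 M1 => [|m IHm] j s1 M1 E vx fr1 qm r1.
    have [ft et] := yields_sub (yields_var r1 ltx) (yields_var r1 lti).
    exists (cost (testE i x)).+1, M1, (setv i j s1); split.
    - apply: ExecWhileFalse => //; rewrite et /= eqxx nxi vx; lia.
    - by rewrite addn0.
    - by [].
    - by move=> z nz /=; move: (nz); rewrite inE negb_or => /andP[/negPf-> _]; apply: fr1.
    - exact: qm.
  have [t1 [M2 [s2 [x2 l2 r2 f2 q2]]]] := IH _ _ _ wf qm r1.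
  have vi2 : vars s2 i = j by rewrite f2 //= eqxx.
  have vx2 : vars s2 x = vars s x by rewrite f2 //= nxi.
  (* The counter stays at or below its limit, which is itself a stored value and hence at most Y; so
     the increment cannot overflow. *)
  have lejY : j.+1 <= Y.
    by apply: leq_trans (bnd_v r ltx); rewrite -E addnS ltnS leq_addr.
  have ya : yields M2 (Add (Deref (regE i)) (Const 1)) (j + 1).
    rewrite -vi2; apply: yields_add (yields_var r2 lti) _ _.
      by apply: yields_const; apply: leYW.
    by rewrite vi2 addn1 leYW // leqW.
  have r3 : rep (setv i j.+1 s2) (update M2 (4 + i * n.+1) j.+1) by apply: rep_setv.
  have [||z|t3 [M3 [s3 [x3 l3 r3' f3 q3]]]] := IHm j.+1 s2 _ _ _ _ q2 r3.
  - by rewrite addSn -addnS.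
  - by [].
  - move=> nz; rewrite -fr1 //; move: nz; rewrite inE negb_or => /andP[nz1 nz2].
    by rewrite f2 //= (negPf nz1).
  have [ft et] := yields_sub (yields_var r1 ltx) (yields_var r1 lti).
  exists (cost (testE i x) + (t1 + (cost (regE i) +
    cost (Add (Deref (regE i)) (Const 1))).+1) + t3).+1, M3, s3.
  split=> //.
  - apply: (ExecWhileTrue (M1 := update M2 (4 + i * n.+1) j.+1)) => //.
    + by rewrite et /= eqxx nxi vx; lia.
    + apply: ExecSeq x2 _; rewrite -[j.+1]addn1.
      exact: exec_store (yields_reg r2 lti) ya.
  - by rewrite mulSn {1}/itercost; lia.
have r0 : rep (setv i 0 s) (update M (4 + i * n.+1) 0) by apply: rep_setv.
have [t [M' [s' [x1 l1 r1 f1 q1]]]] :=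
  loop _ 0 s _ (add0n _) erefl (fun _ _ => erefl) q r0.
exists ((cost (regE i) + 1).+1 + t), M', s'; split=> //.
- apply: ExecSeq x1.
  exact: exec_store (yields_reg r lti) (yields_const _ (leq0n W)).
- move: (leq_mul lex (leqnn (itercost i x + tbound c))).
  rewrite -[tbound (HFor _ _ _ _)]/(headcost i x + lim b * (itercost i x + tbound c)) /headcost.
  lia.
Qed.

End Machine.

(** * Cluster deletion as labelling *)

Section Labels.
Variable V : finType.
Implicit Types (E : {set {set V}}) (f : V -> V) (S : {set V}) (G : graph V).

Definition simple E := forall e, e \in E -> #|e| = 2.
Definition adjE E u v := [set u; v] \in E.
Definition cut E f :=
  [set e in E | [exists u, exists v, [&& u \in e, v \in e & f u != f v]]].
(** No edge set occurs, since S is meant to be a clique, in which every separated pair is an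
    edge. *)
Definition cost_in f S := \sum_(u in S) #|[set v in S | f v != f u]|.

Lemma adjE_sym E u v : adjE E u v = adjE E v u.
Proof. by rewrite /adjE setUC. Qed.

Lemma adjE_irr E u : simple E -> adjE E u u = false.
Proof.
move=> sE; apply/negP=> /sE; by rewrite setUid cards1.
Qed.

Lemma edges_simple G : simple (edges G).
Proof. by move=> e eG; move/'forall_implyP: (card_edges G) => /(_ e eG) /eqP. Qed.

Lemma simpleS E E' : E \subset E' -> simple E' -> simple E.
Proof. by move=> /subsetP sub sE e /sub /sE. Qed.

Lemma adj_cut E f u v : adjE (cut E f) u v = adjE E u v && (f u != f v).
Proof.
rewrite /adjE inE; congr (_ && _); apply/existsP/idP => [[a /existsP[b]]|ne]; last first.
  by exists u; apply/existsP; exists v; rewrite !inE !eqxx orbT.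
rewrite !inE => /and3P[/orP[]/eqP-> /orP[]/eqP->]; rewrite ?eqxx // eq_sym //.
Qed.

(** Double counting of incidences; this converts counts of ordered pairs into numbers of edges. *)
Lemma handshake E : simple E -> \sum_u #|[set v | adjE E u v]| = 2 * #|E|.
Proof.
move=> sE; have E1 u : #|[set v | adjE E u v]| = \sum_(e in E) (u \in e).
  transitivity #|[set e in E | u \in e]|; last first.
    by rewrite -sum1dep_card big_mkcondr; apply: eq_bigr => e _; case: (u \in e).
  rewrite -(@card_in_imset _ _ (fun v => [set u; v])).
    apply: eq_card => e; rewrite inE; apply/imsetP/andP => [[v]|[eE ue]].
      by rewrite inE => uv ->; rewrite !inE eqxx.
    have /cards2P[a [b [ab eab]]] : #|e| == 2 by rewrite sE.
    move: ue; rewrite eab !inE => /orP[]/eqP->; [exists b|exists a] => //.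
      by rewrite inE /adjE -eab.
      by rewrite inE /adjE setUC -eab.
    by rewrite setUC.
  move=> v w; rewrite !inE => uv uw /setP/(_ v); rewrite !inE eqxx orbT.
  by case: eqP => [vu|_ /esym/eqP//]; rewrite vu adjE_irr in uv.
rewrite (eq_bigr _ (fun u _ => E1 u)) exchange_big /=.
rewrite (eq_bigr (fun=> 2)) => [|e eE]; first by rewrite sum_nat_const mulnC.
by rewrite -(sE e eE) -sum1_card [RHS]big_mkcond; apply: eq_bigr => u _; case: (u \in e).
Qed.

Lemma handshake_le E : simple E -> 2 * #|E| <= #|V| * #|V|.
Proof.
move=> sE; rewrite -handshake // -sum_nat_const; apply: leq_sum => u _; exact: max_card.
Qed.

(** Pairs between B and the rest are all separated and are counted in both orders, pairs inside B
    never. The extra term is what [best_table] charges for splitting off a part. *)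
Lemma cost_in_split f S (B : {set V}) : B \subset S ->
  {in B &, forall u v, f u = f v} -> {in B & S :\: B, forall u v, f u != f v} ->
  cost_in f S = cost_in f (S :\: B) + 2 * (#|B| * #|S :\: B|).
Proof.
move=> sBS cB nB; rewrite /cost_in (big_setID B) /= (setIidPr sBS).
rewrite (eq_bigr (fun=> #|S :\: B|)) => [|u uB]; last first.
  apply: eq_card => v; rewrite !inE; case vB: (v \in B); first by rewrite (cB v u) ?eqxx ?andbF.
  by case vS: (v \in S); rewrite //= eq_sym nB // inE vB.
rewrite sum_nat_const.
rewrite [X in _ + X](eq_bigr (fun u => #|B| + #|[set v in S :\: B | f v != f u]|)); last first.
  move=> u uSB; rewrite -cardsUI (_ : _ :&: _ = set0) ?cards0 ?addn0; last first.
    by apply/setP=> v; rewrite !inE; case: (v \in B).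
  apply: eq_card => v; rewrite !inE; case vB: (v \in B) => //=.
  by rewrite (subsetP sBS v vB) /= nB.
rewrite big_split /= sum_nat_const; lia.
Qed.

(** * Optimal splitting of one clique into parts of admissible size *)

Variables g1 g2 : nat.

Definition blocks_ok f S :=
  forall u, u \in S -> g1 <= #|[set v in S | f v == f u]| <= g2.

(* [top] plays the role of infinity. *)
Definition best_table N top (D : nat -> nat) :=
  D 0 = 0 /\ forall s, 0 < s <= N ->
  [/\ D s <= top,
      forall t, 0 < t <= s -> g1 <= t <= g2 -> D s <= D (s - t) + 2 * (t * (s - t))
    & D s = top \/ exists t, [/\ 0 < t <= s, g1 <= t <= g2
                              & D s = D (s - t) + 2 * (t * (s - t))]].

Lemma eq_best_table N top D D' :
  D =1 D' -> best_table N top D -> best_table N top D'.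
Proof.
move=> eD [D0 DS]; split; first by rewrite -eD.
move=> t /DS[H1 H2 H3]; rewrite -eD; split=> // [r lr gg|].
  by rewrite -eD; apply: H2.
by case: H3 => [|[r Hr]]; [left|right; exists r; rewrite -eD].
Qed.

(** Induction on the size of S: the label class of any vertex has an admissible size, so it is one
    of the candidates of the recurrence, and the other classes split what remains. *)
Lemma best_le N top D f S : best_table N top D -> #|S| <= N -> blocks_ok f S ->
  D #|S| <= cost_in f S.
Proof.
case=> D0 DS; have [m] := ubnP #|S|; elim: m S => // m IH S; rewrite ltnS => leSm leN ok.
have [->|[u uS]] := set_0Vmem S; first by rewrite cards0 D0.
set B := [set v in S | f v == f u].
have sBS : B \subset S by apply/subsetP=> v; rewrite inE => /andP[].
have uB : u \in B by rewrite inE uS eqxx.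
have B0 : 0 < #|B| by apply/card_gt0P; exists u.
have cB : #|S :\: B| = #|S| - #|B| by rewrite cardsD (setIidPr sBS).
have leB := subset_leq_card sBS.
rewrite (@cost_in_split f S B) //; last 2 first.
- by move=> v w; rewrite !inE => /andP[_ /eqP->] /andP[_ /eqP->].
- move=> v w; rewrite !inE => /andP[_ /eqP->] /andP[].
  by rewrite negb_and => /orP[/negPf->//|]; rewrite eq_sym.
have [|_ /(_ #|B|) Dle _] := DS #|S|; first lia.
rewrite cB; apply: leq_trans (Dle _ (ok u uS)) _; first by rewrite B0.
rewrite leq_add2r -cB; apply: IH; [lia|lia|].
move=> v; rewrite inE => /andP[vB vS].
rewrite (_ : [set w in S :\: B | _] = [set w in S | f w == f v]); first exact: ok.
apply/setP=> w; rewrite !inE; case wS: (w \in S); rewrite ?andbF //=.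
case: (f w =P f v) => [Ewv|]; rewrite ?andbF //= Ewv.
by move: vB; rewrite inE vS /= => ->.
Qed.

(** A value below [top] is realised by some part size t; any t elements of S may form that part.
    Labels are kept inside S so that the new label differs from those of the remainder, and later so
    that distinct cliques share no label. *)
Lemma best_attained N top D S : best_table N top D -> #|S| <= N -> D #|S| < top ->
  exists f, [/\ {in S, forall u, f u \in S}, blocks_ok f S & cost_in f S = D #|S|].
Proof.
case=> D0 DS; have [m] := ubnP #|S|; elim: m S => // m IH S; rewrite ltnS => leSm leN lttop.
have [->|[u uS]] := set_0Vmem S.
  exists id; split=> [v|v|]; rewrite ?inE // cards0 D0 /cost_in big_set0 //.
have S0 : 0 < #|S| by apply/card_gt0P; exists u.
have [|_ _ [Etop|[t [tS tg Dt]]]] := DS #|S|; [lia|by rewrite Etop ltnn in lttop|].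
have [B sBS cB] : exists2 B : {set V}, B \subset S & #|B| = t.
  have: 0 < #|[set B : {set V} | B \subset S & #|B| == t]|.
    by rewrite cards_draws bin_gt0; lia.
  by case/card_gt0P=> B; rewrite inE => /andP[? /eqP ?]; exists B.
have [b bB] : exists b, b \in B by apply/card_gt0P; lia.
have cSB : #|S :\: B| = #|S| - t by rewrite cardsD (setIidPr sBS) cB.
have [|||f [fS fok fc]] := IH (S :\: B);
  [rewrite cSB; lia|rewrite cSB; lia| |].
  by rewrite cSB; apply: leq_ltn_trans lttop; rewrite Dt leq_addr.
have nB v : v \in S :\: B -> f v != b.
  by move/fS; apply: contraTneq => ->; rewrite inE bB.
exists (fun v => if v \in B then b else f v); split.
- move=> v vS; case: ifP => vB; first exact: (subsetP sBS).
  by have := fS v; rewrite !inE vB vS => /(_ isT)/andP[].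
- move=> v vS; case: ifP => vB.
    rewrite (_ : [set w in S | _] = B) ?cB //; apply/setP=> w; rewrite inE.
    case wB: (w \in B); first by rewrite eqxx (subsetP sBS).
    by case wS: (w \in S); rewrite //= (negPf (nB w _)) // inE wB wS.
  have vSB : v \in S :\: B by rewrite inE vB vS.
  rewrite (_ : [set w in S | _] = [set w in S :\: B | f w == f v]); first exact: fok.
  apply/setP=> w; rewrite !inE; case wB: (w \in B) => //=.
  by rewrite eq_sym (negPf (nB v vSB)) andbF.
rewrite (@cost_in_split _ S B) //.
- rewrite cB Dt -cSB -fc; congr (_ + _); apply: eq_bigr => v; rewrite inE => /andP[/negPf vB vS].
  apply: eq_card => w; rewrite !inE vB; case: (w \in B) => //.
- by move=> v w -> ->.
- move=> v w vB wSB; rewrite vB; move: (wSB); rewrite inE => /andP[/negPf-> _].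
  by rewrite eq_sym nB.
Qed.

Definition good G f :=
  (forall u v, f u = f v -> u != v -> adj G u v) /\ blocks_ok f [set: V].

(** Given F, vertices are labelled by the roots of their components, and the cut of this labelling
    lies in F. Given f, deleting its cut leaves the label classes as components: remaining edges
    stay within a class, and each class is a clique. *)
Lemma CCClusterDeletion_label G k :
  CCClusterDeletion G g1 g2 k <-> exists2 f, good G f & #|cut (edges G) f| <= k.
Proof.
split=> [/existsP[F /and4P[FG Fk clF ccF]]|[f [fad fok] fk]].
  have symH : connect_sym (adj (del_edges G F)).
    by apply: sym_connect_sym => u v; rewrite /adj setUC.
  set f := root (adj (del_edges G F)).
  have fE u v : (f u == f v) = connect (adj (del_edges G F)) u v by rewrite root_connect.
  have compE u : [set v in [set: V] | f v == f u] = component (del_edges G F) u.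
    by apply/setP=> v; rewrite !inE /= fE symH.
  have inC u : component (del_edges G F) u \in components (del_edges G F).
    by apply/imsetP; exists u.
  exists f; first split.
  - move=> u v /eqP; rewrite fE => cuv ne.
    move/'forall_implyP: clF => /(_ _ (inC u)) /'forall_implyP/(_ u).
    rewrite inE connect0 => /(_ isT) /'forall_implyP/(_ v); rewrite inE => /(_ cuv).
    by move/implyP=> /(_ ne); rewrite /adj inE => /andP[].
  - move=> u _; rewrite compE; move/'forall_implyP: ccF; exact.
  - apply: leq_trans Fk; apply: subset_leq_card; apply/subsetP=> e; rewrite inE.
    case/andP=> eG /existsP[u /existsP[v /and3P[ue ve]]]; apply: contraNT => eF.
    have [->|ne] := eqVneq u v; first by rewrite eqxx.
    rewrite fE; apply: connect1; rewrite /adj inE.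
    suff -> : [set u; v] = e by rewrite eF.
    by apply/eqP; rewrite eqEcard subUset !sub1set ue ve cards2 ne (edges_simple eG).
apply/existsP; exists (cut (edges G) f).
set H := del_edges G _.
have adjH u v : adj H u v = adj G u v && (f u == f v).
  rewrite {1}/adj inE andbC -/(adjE (cut _ _) u v) adj_cut.
  by rewrite -/(adj G u v) /adjE -/(adj G u v); case: (adj G u v); rewrite //= negbK.
have compE u : component H u = [set v in [set: V] | f v == f u].
  apply/setP=> v; rewrite !inE; apply/idP/idP=> [|/eqP fuv].
    case/connectP=> p + ->; elim: p u => //= w p IH u.
    by rewrite adjH => /andP[/andP[_ /eqP->]]; apply: IH.
  have [->|ne] := eqVneq v u; first exact: connect0.
  by apply: connect1; rewrite adjH fuv eqxx fad // eq_sym.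
apply/and4P; split=> //.
- by apply/subsetP=> e; rewrite inE => /andP[].
- apply/'forall_implyP=> _ /imsetP[u _ ->]; rewrite compE.
  apply/'forall_implyP=> v; rewrite !inE => /eqP fv.
  apply/'forall_implyP=> w; rewrite !inE => /eqP fw; apply/implyP=> ne.
  by rewrite adjH fv fw eqxx fad // fv fw.
- by apply/'forall_implyP=> _ /imsetP[u _ ->]; rewrite compE fok.
Qed.
End Labels.

(** * Leaves of the search tree *)

Section Classes.
Variable n : nat.
Local Notation V := 'I_n.
Implicit Types (E : {set {set V}}) (f : V -> V).

Definition p3 E (u v w : V) :=
  [&& adjE E u v, adjE E v w, u != w & ~~ adjE E u w].
Definition p3free E := forall u v w, ~~ p3 E u v w.
Definition class E (u : V) : {set V} := [set v | (v == u) || adjE E u v].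
Definition isrep E (u : V) := [forall v : V, (v < u) ==> ~~ adjE E u v].

Variable E : {set {set V}}.
Hypotheses (sE : simple E) (fE : p3free E).

Lemma class_refl u : u \in class E u.
Proof. by rewrite inE eqxx. Qed.

Lemma class_sym u v : (u \in class E v) = (v \in class E u).
Proof. by rewrite !inE eq_sym adjE_sym. Qed.

(** Without induced paths on three vertices, being adjacent or equal is transitive. *)
Lemma class_trans u v w : v \in class E u -> w \in class E v -> w \in class E u.
Proof.
rewrite !inE => /orP[/eqP->//|uv] /orP[/eqP->|vw]; first by rewrite uv orbT.
have [->|ne] //= := eqVneq w u.
by have := fE u v w; rewrite /p3 uv vw eq_sym ne /= negbK.
Qed.

Lemma class_eq u v : v \in class E u -> class E v = class E u.
Proof.
move=> vu; apply/setP=> w; apply/idP/idP; first exact: class_trans.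
by apply: class_trans; rewrite class_sym.
Qed.

Definition repr u : V := [arg min_(v < u in class E u) (v : nat)].

Lemma reprP u : repr u \in class E u /\ isrep E (repr u).
Proof.
rewrite /repr; case: arg_minnP => [|r ru rmin]; first exact: class_refl.
split=> //; apply/forallP=> v; apply/implyP=> ltv; apply: contraL ltv => rv.
rewrite -leqNgt; apply: rmin; apply: class_trans ru _.
by rewrite inE rv orbT.
Qed.

Lemma rep_uniq r r' : isrep E r -> isrep E r' -> r' \in class E r -> r' = r.
Proof.
move=> /forallP Hr /forallP Hr'; rewrite inE => /orP[/eqP//|ad].
case: (ltngtP r r') => [lt|lt|/val_inj//].
  by have := Hr' r; rewrite lt adjE_sym ad.
by have := Hr r'; rewrite lt ad.
Qed.

Lemma repr_eq u r : isrep E r -> (repr u == r) = (u \in class E r).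
Proof.
have [ru rr] := reprP u; move=> Hr; apply/eqP/idP => [<-|ur]; first by rewrite class_sym.
by apply: rep_uniq => //; rewrite -(class_eq ur).
Qed.

(** The handshake identity is applied to the cut itself, and the vertices are grouped by
    representative. Inside a clique every separated pair is a cut edge, and E has no edges between
    cliques. *)
Lemma sum_classes f :
  \sum_(r | isrep E r) cost_in f (class E r) = 2 * #|cut E f|.
Proof.
rewrite -handshake; last first.
  by apply: simpleS sE; apply/subsetP=> e; rewrite inE => /andP[].
rewrite [RHS](partition_big repr (isrep E)) /= => [|u _]; last by case: (reprP u).
apply: eq_bigr => r rr; apply: eq_big => [u|u ur]; first by rewrite repr_eq.
rewrite -(class_eq ur); apply: eq_card => v; rewrite !inE adj_cut (eq_sym (f u)).
by case: eqP => // ->; rewrite adjE_irr // eqxx andbF.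
Qed.

Variables (g1 g2 top : nat) (D : nat -> nat) (G : graph V).
Hypotheses (bD : best_table g1 g2 n top D) (EG : E \subset edges G).

Lemma card_classN u : #|class E u| <= n.
Proof. by rewrite -[X in _ <= X]card_ord max_card. Qed.

(** As E retains every edge inside a cluster of f, each cluster lies within one clique, so f
    restricted to a clique still has parts of admissible size. *)
Lemma classes_le f : good g1 g2 G f ->
  (forall u v, adj G u v -> f u = f v -> adjE E u v) ->
  \sum_(r | isrep E r) D #|class E r| <= 2 * #|cut E f|.
Proof.
move=> [fad fok] kept; rewrite -sum_classes; apply: leq_sum => r _.
apply: best_le bD (card_classN r) _ => u ur.
rewrite (_ : [set v in _ | _] = [set v in [set: V] | f v == f u]); first exact: fok.
apply/setP=> v; rewrite -(class_eq ur) !inE; case: (f v =P f u); rewrite ?andbF ?andbT //= => fvu.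
have [|ne] //= := eqVneq v u; have uv : u != v by rewrite eq_sym.
by rewrite (kept u v (fad u v (esym fvu) uv) (esym fvu)).
Qed.

(** Optimal labellings of the single cliques are glued. The bound on the sum keeps each term below
    [top], and labels taken from the own clique never collide with those of another. *)
Lemma classes_attained : \sum_(r | isrep E r) D #|class E r| < top ->
  exists2 f, good g1 g2 G f & 2 * #|cut E f| = \sum_(r | isrep E r) D #|class E r|.
Proof.
move=> lt; have ex r : exists f, isrep E r ->
    [/\ {in class E r, forall u, f u \in class E r}, blocks_ok g1 g2 f (class E r)
      & cost_in f (class E r) = D #|class E r|].
  case rr: (isrep E r); last by exists id.
  have [|f] := best_attained bD (card_classN r); last by exists f.
  by apply: leq_ltn_trans lt; rewrite (bigD1 r) //= leq_addr.
have [F HF] := fin_all_exists ex.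
set f := fun u => F (repr u) u.
have fr r u : isrep E r -> u \in class E r -> f u = F r u.
  by move=> rr ur; rewrite /f; move: ur; rewrite -repr_eq // => /eqP->.
have same u v : f u = f v -> v \in class E u.
  have [ru rr] := reprP u; have [rv rr'] := reprP v => fuv.
  have [H1 _ _] := HF _ rr; have [H2 _ _] := HF _ rr'.
  have := H1 u; rewrite class_sym => /(_ ru); rewrite -/(f u) fuv => fv1.
  have := H2 v; rewrite class_sym => /(_ rv); rewrite -/(f v) => fv2.
  rewrite -(class_eq ru) -(class_eq fv1) (class_eq fv2) class_sym.
  exact: rv.
exists f.
  split=> [u v /same|u _].
    by rewrite inE => /orP[/eqP->|/(subsetP EG)//]; rewrite eqxx.
  have [ru rr] := reprP u; have [_ ok _] := HF _ rr.
  have ur : u \in class E (repr u) by rewrite class_sym.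
  have := ok u ur; rewrite (_ : [set v in class E _ | _] = [set v in [set: V] | f v == f u]) //.
  apply/setP=> v; rewrite !inE /=; apply/idP/idP=> [|/eqP fvu].
    case/andP=> vr /eqP; rewrite -[_ || _]/(true && _) in vr *.
    have vr' : v \in class E (repr u) by rewrite inE.
    by rewrite -!(fr (repr u)) // => ->.
  have vu : v \in class E (repr u) by rewrite (class_eq ru); apply: same.
  by rewrite -!(fr (repr u)) // fvu eqxx andbT; rewrite inE in vu.
rewrite -sum_classes; apply: eq_bigr => r rr; have [_ _ <-] := HF _ rr.
apply: eq_bigr => u ur; apply: eq_card => v; rewrite !inE.
case vr: (_ || _) => //=; by rewrite (fr r u) // (fr r v) // inE.
Qed.
End Classes.

(** * Branching *)

Section Fold.
Variables (T : Type) (d : T -> nat).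

Definition progress (g : T -> T) := forall a, g a = a \/ d a < d (g a).

Lemma progress_foldl (I : Type) (f : T -> I -> T) s :
  (forall x, progress (f^~ x)) -> progress (fun a => foldl f a s).
Proof.
move=> pf; elim: s => [|x s IH] a /=; first by left.
by case: (pf x a) (IH (f a x)) => [->//|lt [->|lt']]; right=> //; apply: ltn_trans lt lt'.
Qed.

(** The measure rises with every change and never falls, so a fold that returns to its start has not
    moved in between. *)
Lemma foldl_fixed (I : eqType) (f : T -> I -> T) s a :
  (forall x, progress (f^~ x)) -> foldl f a s = a -> {in s, forall x, f a x = a}.
Proof.
move=> pf; elim: s => //= y s IH.
have [E|lt] := pf y a; last first.
  case: (progress_foldl s pf (f a y)) => [->|lt'] E; first by rewrite E ltnn in lt.
  by have := ltn_trans lt lt'; rewrite E ltnn.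
by rewrite E => Es x; rewrite inE => /orP[/eqP->//|]; apply: IH.
Qed.

Lemma progress_iter g m a : progress g ->
  g (iter m g a) = iter m g a \/ d a + m <= d (iter m g a).
Proof.
move=> pg; elim: m => [|m IH] /=; first by right; rewrite addn0.
case: IH => [E|le]; first by left; rewrite !E.
by case: (pg (iter m g a)) => [E|lt]; [left; rewrite !E | right; lia].
Qed.

Lemma foldl_const (I : Type) (g : T -> T) a (s : seq I) :
  foldl (fun a _ => g a) a s = iter (size s) g a.
Proof. by elim: s a => //= x s IH a; rewrite IH -iterSr. Qed.
End Fold.

Section Branch.
Variables (n k g1 g2 : nat) (G : graph 'I_n).
Local Notation V := 'I_n.
Local Notation bstate := ({set {set V}} * nat * nat)%type.

(* In (E, y, d) the edges E are left after d deletions, and y / 2^k is the binary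
   fraction formed by the digits still unread: doubling y moves the next digit
   into the carry. The budget is not tested here, it is compared with the total
   cost at the leaf. *)
Definition step (a : bstate) (u v w : V) : bstate :=
  let: (E, y, d) := a in
  if p3 E u v w then
    if 2 ^ k <= y + y then (E :\ [set u; v], y + y - 2 ^ k, d.+1)
    else (E :\ [set v; w], y + y, d.+1)
  else a.

Definition pass (a : bstate) : bstate :=
  foldl (fun a u => foldl (fun a v => foldl (fun a w => step a u v w) a
    (enum V)) a (enum V)) a (enum V).

(* A pass that finds a path deletes an edge, so n^2 passes leave none. *)
Definition branch (a : bstate) : bstate :=
  foldl (fun a (_ : V) => foldl (fun a (_ : V) => pass a) a (enum V)) a (enum V).

(** This holds whatever the digits are. The bound on y limits its double to [top], and the count of
    deletions makes the cost of every leaf an honest one. *)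
Definition binv (a : bstate) :=
  [/\ a.1.1 \subset edges G, a.1.2 < 2 ^ k & a.2 = #|edges G :\: a.1.1|].

Lemma step_inv a u v w : binv a -> binv (step a u v w).
Proof.
case: a => [[E y] d] [/= EG lty ->]; rewrite /step.
have rm e : e \in E -> E :\ e \subset edges G /\
    #|edges G :\: E|.+1 = #|edges G :\: (E :\ e)|.
  move=> eE; split; first by apply: subset_trans (subsetDl _ _) EG.
  rewrite (cardsD1 e (edges G :\: (E :\ e))) !inE eqxx (subsetP EG) //= add1n.
  by congr _.+1; apply: eq_card => e'; rewrite !inE; case: eqP => // ->; rewrite eE.
case: ifP => [/and4P[uv vw _ _]|_]; last by split.
by case: leqP => ly; [have [? ?] := rm _ uv | have [? ?] := rm _ vw]; split=> //=; lia.
Qed.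

Lemma foldl_inv (T I : Type) (P : T -> Prop) (f : T -> I -> T) s a :
  (forall a x, P a -> P (f a x)) -> P a -> P (foldl f a s).
Proof. by move=> Pf; elim: s a => //= x s IH a /Pf - /(_ x); apply: IH. Qed.

Lemma branch_inv a : binv a -> binv (branch a).
Proof. by do 6?[apply: foldl_inv => {}a ? {}]; apply: step_inv. Qed.

Lemma step_progress u v w : progress snd (fun a => step a u v w).
Proof.
case=> [[E y] d]; rewrite /step; case: ifP => _; last by left.
by case: ifP => _; right.
Qed.

Lemma pass_progress : progress snd pass.
Proof. by do 3?[apply: progress_foldl => ?]; apply: step_progress. Qed.

Lemma pass_fixed a : pass a = a -> p3free a.1.1.
Proof.
case: a => [[E y] d] fx u v w.
have P3 u' v' := progress_foldl (enum V) (step_progress u' v').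
have P2 u' := progress_foldl (enum V) (P3 u').
have e1 := foldl_fixed P2 fx (etrans (mem_enum V u) isT).
have e2 := foldl_fixed (P3 u) e1 (etrans (mem_enum V v) isT).
have := foldl_fixed (step_progress u v) e2 (etrans (mem_enum V w) isT).
rewrite /step /=; case: ifP => // _.
by case: ifP => _ [_ _] /(congr1 (subn^~ d)); rewrite subSnn subnn.
Qed.

Lemma branch_p3free a : binv a -> p3free (branch a).1.1.
Proof.
move=> inva u; have n0 : 0 < n by apply: leq_trans (ltn_ord u).
move: u; apply: pass_fixed; have [_ _ dE] := branch_inv inva.
move: dE; rewrite /branch foldl_const size_enum_ord.
rewrite (eq_iter (f' := iter n pass)) => [|b]; last by rewrite foldl_const size_enum_ord.
rewrite -iterM.
(* If no fixed point had been reached, at least n^2 > 0 edges would be gone, whereas twice the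
   number of edges is at most n^2. *)
case: (progress_iter (n * n) a pass_progress) => // le dE.
have := handshake_le (@edges_simple _ G); rewrite card_ord.
have := subset_leq_card (subsetDl (edges G) (iter (n * n) pass a).1.1).
rewrite -dE; move: le; have : 0 < n * n by rewrite muln_gt0 n0.
by lia.
Qed.

(** * Completeness: following a solution to a leaf *)

Section Guided.
Variable f : V -> V.
Hypothesis gf : good g1 g2 G f.

Definition kept (E : {set {set V}}) :=
  forall u v, adj G u v -> f u = f v -> adjE E u v.
(** The number m is both the remaining budget and the number of unread digits: in [guided], y equals
    z * 2^(k - m) with z < 2^m. *)
Definition ginv (E : {set {set V}}) m := [/\ E \subset edges G, kept E, #|cut E f| <= m & m <= k].
(* The choices that follow f lead from E to some E'; the digits that make them are
   prefixed to an arbitrary continuation z'. Quantifying over z' makes the property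
   compositional. *)
Definition guided (g : bstate -> bstate) := forall E m, ginv E m ->
  exists E' m', ginv E' m' /\ forall z', z' < 2 ^ m' ->
  exists2 z, z < 2 ^ m &
    g (E, z * 2 ^ (k - m), k - m) = (E', z' * 2 ^ (k - m'), k - m').

Lemma guided_foldl (I : Type) (h : bstate -> I -> bstate) s :
  (forall x, guided (h^~ x)) -> guided (fun a => foldl h a s).
Proof.
move=> gh; elim: s => [|x s IH] E m iE.
  by exists E, m; split=> // z lt; exists z.
have [E1 [m1 [i1 H1]]] := gh x E m iE.
have [E2 [m2 [i2 H2]]] := IH E1 m1 i1.
exists E2, m2; split=> // z2 /H2[z1 /H1[z lt Ez] Ez1].
by exists z => //=; rewrite Ez.
Qed.

Lemma ginv_rm E m u v : ginv E m -> adjE (cut E f) u v ->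
  0 < m /\ ginv (E :\ [set u; v]) m.-1.
Proof.
case=> EG kE cm mk cuv; set e := [set u; v].
have ce : #|cut (E :\ e) f| < #|cut E f|.
  rewrite [X in _ < X](cardsD1 e) [e \in _]cuv add1n ltnS subset_leq_card //.
  by apply/subsetP=> e'; rewrite !inE => /andP[/andP[-> ->] ->].
split; first by lia.
split; [exact: subset_trans (subsetDl _ _) EG | | lia | lia].
move=> a b ab fab; rewrite /adjE !inE -/(adjE E a b) kE // andbT.
apply/eqP=> ee; move: cuv; rewrite /adjE -/e -ee -/(adjE _ a b) adj_cut fab eqxx.
by rewrite andbF.
Qed.

(** If f separates u from v, the digit 1 deletes that edge. Otherwise f separates v from w, for else
    u and w would share a cluster, hence be adjacent in E, and the path would not be induced; then
    the digit is 0. *)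
Lemma guided_step u v w : guided (fun a => step a u v w).
Proof.
move=> E m iE; have [EG kE cm mk] := iE.
have [P|/negPf P] := boolP (p3 E u v w); last first.
  by exists E, m; split=> // z lt; exists z; rewrite // /step P.
have /and4P[uv vw uw nuw] := P.
have dbl m' : m = m'.+1 -> forall z, z * 2 ^ (k - m) + z * 2 ^ (k - m) = z * 2 ^ (k - m').
  move=> em z; rewrite -mulnDr addnn -mul2n -expnS; congr (_ * 2 ^ _); lia.
have pk m' : m = m'.+1 -> 2 ^ m' * 2 ^ (k - m') = 2 ^ k.
  by move=> em; rewrite -expnD subnKC //; lia.
have small m' z : m = m'.+1 -> z < 2 ^ m' -> z * 2 ^ (k - m') < 2 ^ k.
  by move=> em lt; rewrite -(pk m' em) ltn_pmul2r // expn_gt0.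
have [fuv|fuv] := eqVneq (f u) (f v); last first.
  have [m0 i'] : 0 < m /\ ginv (E :\ [set u; v]) m.-1.
    by apply: ginv_rm; rewrite // adj_cut uv fuv.
  have em : m = m.-1.+1 by lia.
  exists (E :\ [set u; v]), m.-1; split=> // z' lt.
  (* Prefixing the digit 1 adds the top power of two; doubling carries it out and [step] subtracts
     it. *)
  exists (2 ^ m.-1 + z').
    by rewrite {2}em expnS mul2n -addnn ltn_add2l.
  rewrite /step P (dbl _ em) mulnDl (pk _ em) leq_addr addKn; congr (_, _, _); lia.
have fvw : f v != f w.
  apply/eqP=> fvw; case/negP: nuw; apply: kE; last by rewrite fuv.
  by case: gf => fad _; apply: fad; rewrite // fuv.
have [m0 i'] : 0 < m /\ ginv (E :\ [set v; w]) m.-1.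
  by apply: ginv_rm; rewrite // adj_cut vw fvw.
have em : m = m.-1.+1 by lia.
exists (E :\ [set v; w]), m.-1; split=> // z' lt; exists z'.
  by apply: leq_trans lt _; rewrite leq_exp2l //; lia.
rewrite /step P (dbl _ em) leqNgt (small _ _ em lt) /=; congr (_, _, _); lia.
Qed.

Lemma branch_guided : #|cut (edges G) f| <= k ->
  exists2 x, x < 2 ^ k & let: (E, y, d) := branch (edges G, x, 0) in
    kept E /\ #|cut E f| + d <= k.
Proof.
move=> ck.
have gb : guided branch by do 5?[apply: guided_foldl => ?]; apply: guided_step.
have i0 : ginv (edges G) k by split=> //; move=> u v.
have [E [m [[_ kE cm mk] H]]] := gb _ _ i0.
(* The digits left unread at the leaf are arbitrary; they are set to 0. *)
have [|x ltx] := H 0; first by rewrite expn_gt0.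
rewrite subnn expn0 muln1 => E0; exists x => //; rewrite E0; split=> //; lia.
Qed.
End Guided.

Definition leaf_cost (D : nat -> nat) (a : bstate) :=
  \sum_(r | isrep a.1.1 r) D #|class a.1.1 r| + (a.2 + a.2).

Lemma branch_decides D : best_table g1 g2 n (2 ^ k + 2 ^ k) D ->
  CCClusterDeletion G g1 g2 k <->
  exists2 x, x < 2 ^ k & leaf_cost D (branch (edges G, x, 0)) <= k + k.
Proof.
move=> bD; rewrite CCClusterDeletion_label.
have i0 x : x < 2 ^ k -> binv (edges G, x, 0) by split=> //=; rewrite setDv cards0.
split=> [[f gf ck]|[x ltx]].
  have [x ltx Hx] := branch_guided gf ck; exists x => //; move: Hx.
  have := branch_p3free (i0 x ltx); have := branch_inv (i0 x ltx).
  case: (branch _) => [[E y] d] [/= EG _ dE] fE [kE le]; rewrite /leaf_cost /=.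
  have sE := simpleS EG (@edges_simple _ G).
  apply: leq_trans (leq_add (classes_le sE fE bD gf kE) (leqnn _)) _.
  by rewrite mul2n -addnn addnACA leq_add.
have := branch_p3free (i0 x ltx); have := branch_inv (i0 x ltx).
case: (branch _) => [[E y] d] [/= EG _ dE] fE; rewrite /leaf_cost /= => le.
have sE := simpleS EG (@edges_simple _ G).
have [|f gf cE] := classes_attained sE fE bD EG.
  (* Because k < 2^k, a total within the doubled budget lies below [top], so no infinite entry takes
     part in it. *)
  apply: leq_ltn_trans (leq_trans (leq_addr _ _) le) _.
  by have := @ltn_expl 2 k isT; lia.
exists f => //.
have sub : cut (edges G) f \subset (edges G :\: E) :|: cut E f.
  by apply/subsetP=> e; rewrite !inE => /andP[-> ->]; case: (e \in E).
apply: leq_trans (subset_leq_card sub) _.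
apply: leq_trans (leq_card_setU (edges G :\: E) (cut E f)).1 _.
move: le; rewrite -dE -cE mul2n -addnn addnACA !addnn leq_double.
by rewrite addnC.
Qed.
End Branch.

(** * The program *)

Local Notation rSq := 0 (only parsing).
Local Notation rN := 1 (only parsing).
Local Notation rK := 2 (only parsing).
Local Notation rP := 3 (only parsing).
Local Notation rG1 := 4 (only parsing).
Local Notation rG2 := 5 (only parsing).
Local Notation rAns := 6 (only parsing).
Local Notation rX := 7 (only parsing).
Local Notation rY := 8 (only parsing).
Local Notation rD := 9 (only parsing).
Local Notation rU := 10 (only parsing).
Local Notation rV := 11 (only parsing).
Local Notation rW := 12 (only parsing).
Local Notation rI := 13 (only parsing).
Local Notation rJ := 14 (only parsing).
Local Notation rT := 15 (only parsing).
Local Notation aRow := 0 (only parsing).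
Local Notation aMat := 1 (only parsing).
Local Notation aBest := 2 (only parsing).

Local Notation "c1 ;; c2" := (HSeq c1 c2) (at level 90, right associativity).
Local Notation "e1 |+| e2" := (HAdd e1 e2) (at level 50, left associativity).
Local Notation "e1 |-| e2" := (HSub e1 e2) (at level 50, left associativity).
Local Notation "$ i" := (HV i) (at level 9, format "$ i").

Definition load_params :=
  HSet rN (HIn (HC 0)) ;; HSet rG1 (HIn (HC 1)) ;; HSet rG2 (HIn (HC 2)) ;;
  HSet rK (HIn (HC 3)).

(** The accumulation relies on register 0 being 0 in the input. *)
Definition make_square := HFor false rU rN (HSet rSq ($rSq |+| $rN)).

(** The flag is [true] because k may exceed n, while k < 2^k always. *)
Definition make_power :=
  HSet rP (HC 1) ;; HFor true rU rK (HSet rP ($rP |+| $rP)).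

(** A table of row offsets, since u * n + v cannot be computed directly. *)
Definition make_rows :=
  HSet rT (HC 0) ;;
  HFor false rU rN (HSetA aRow $rU $rT ;; HSet rT ($rT |+| $rN)).

(** The number of summands rV + 1 sits in no register that could serve as a limit, so the loop runs
    to n and a guard skips the surplus rounds. *)
Definition make_product :=
  HSet rW (HC 0) ;;
  HFor false rJ rN
    (HIf ($rV |+| HC 1 |-| $rJ) (HSet rW ($rW |+| ($rU |-| $rV) |+| ($rU |-| $rV))) HSkip).

(* With s = rU + 1 and t = rV + 1 the loop body minimises best[s - t] + 2t(s - t). *)
Definition make_best :=
  HFor false rU rN
   (HSet rI ($rP |+| $rP) ;;
    HFor false rV rN
     (* A sum of truncated differences is nonzero as soon as one of them is: it encodes a
        disjunction of strict inequalities. *)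
     (HIf (($rV |-| $rU) |+| ($rG1 |-| ($rV |+| HC 1)) |+| ($rV |+| HC 1 |-| $rG2)) HSkip
       (make_product ;;
        HIf ($rI |-| (HA aBest ($rU |-| $rV) |+| $rW))
          (HSet rI (HA aBest ($rU |-| $rV) |+| $rW)) HSkip)) ;;
    HSetA aBest ($rU |+| HC 1) $rI).

Definition cell u v := HA aRow $u |+| $v.
Definition neq u v := ($u |-| $v) |+| ($v |-| $u).

(* The diagonal is cleared rather than copied, since it holds registers. *)
Definition copy_matrix :=
  HFor false rU rN (HFor false rV rN
    (HIf (neq rU rV) (HSetA aMat (cell rU rV) (HIn (HC 4 |+| cell rU rV)))
                     (HSetA aMat (cell rU rV) (HC 0)))).

Definition remove_edge u v :=
  HSetA aMat (cell u v) (HC 0) ;; HSetA aMat (cell v u) (HC 0).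

Definition branch_step :=
  HIf (HA aMat (cell rU rV)) (HIf (HA aMat (cell rV rW)) (HIf (neq rU rW)
    (HIf (HA aMat (cell rU rW)) HSkip
      (HSet rY ($rY |+| $rY) ;;
       HIf ($rP |-| $rY) (remove_edge rV rW)
         (HSet rY ($rY |-| $rP) ;; remove_edge rU rV) ;;
       HSet rD ($rD |+| HC 1))) HSkip) HSkip) HSkip.

Definition run_branch :=
  HFor false rI rN (HFor false rJ rN
    (HFor false rU rN (HFor false rV rN (HFor false rW rN branch_step)))).

(** [rJ] starts at 1 because a class contains its own vertex. *)
Definition count_neighbours :=
  HSet rJ (HC 1) ;; HSet rT (HC 0) ;;
  HFor false rV rN
    (HIf (HA aMat (cell rU rV))
      (HSet rJ ($rJ |+| HC 1) ;; HIf ($rU |-| $rV) (HSet rT ($rT |+| HC 1)) HSkip) HSkip).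

(* [rT] counts the neighbours below rU, so each clique is charged at its least
   vertex only. *)
Definition sum_best :=
  HSet rI (HC 0) ;;
  HFor false rU rN
    (count_neighbours ;;
     HIf $rT HSkip (HSet rI ($rI |+| HA aBest $rJ))).

(** [rAns] is only ever raised, so it accumulates the disjunction over all x. *)
Definition try_leaf :=
  HSet rY $rX ;; HSet rD (HC 0) ;; copy_matrix ;; run_branch ;; sum_best ;;
  HIf ($rI |+| ($rD |+| $rD) |-| ($rK |+| $rK)) HSkip (HSet rAns (HC 1)).

Definition solver :=
  load_params ;; make_square ;; make_power ;; make_rows ;; make_best ;;
  HFor true rX rP try_leaf.

Lemma solver_wf : wfc solver.
Proof. by vm_compute. Qed.

(** * Verification of the program *)

Section Solver.
Variables (n g1 g2 k : nat) (G : graph 'I_n).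
Local Notation V := 'I_n.
Local Notation inp := (input G g1 g2 k).

(** A bound for all stored values, among them 2n^2 from the products and n * [top] from the sum over
    the cliques. The base is at least 2, so the third power also absorbs the factors 2. *)
Definition wbound := 2 ^ k * (n + g1 + g2 + 2) ^ 3.
Local Notation Y := wbound.
Local Notation wp := (wp n k Y inp).
Local Notation top := (2 ^ k + 2 ^ k).

Lemma wp_seq c1 c2 Q s : wp c1 (wp c2 Q) s -> wp (c1 ;; c2) Q s.
Proof. by []. Qed.

Lemma le_wbound a x : a <= 2 ^ k -> x <= (n + g1 + g2 + 2) ^ 3 -> a * x <= Y.
Proof. exact: leq_mul. Qed.

Lemma le_wbound1 x : x <= (n + g1 + g2 + 2) ^ 3 -> x <= Y.
Proof. by move=> le; rewrite -[x]mul1n le_wbound // expn_gt0. Qed.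

Lemma n_le : n <= Y. Proof. by apply: le_wbound1; rewrite !expnS expn0; nia. Qed.
Lemma n1_le : n.+1 <= Y. Proof. by apply: le_wbound1; rewrite !expnS expn0; nia. Qed.
Lemma nn2_le : 2 * (n * n) <= Y. Proof. by apply: le_wbound1; rewrite !expnS expn0; nia. Qed.
Lemma nn_le : n * n <= Y. Proof. by apply: le_wbound1; rewrite !expnS expn0; nia. Qed.
Lemma g1_le : g1 <= Y. Proof. by apply: le_wbound1; rewrite !expnS expn0; nia. Qed.
Lemma g2_le : g2 <= Y. Proof. by apply: le_wbound1; rewrite !expnS expn0; nia. Qed.
Lemma one_le : 1 <= Y. Proof. by apply: le_wbound1; rewrite expn_gt0 addn2. Qed.
Lemma ntop_le : n * top <= Y.
Proof.
have -> : n * top = 2 ^ k * (n * 2) by lia.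
by rewrite le_wbound // !expnS expn0; nia.
Qed.
Lemma top_le : top <= Y.
Proof. by rewrite addnn -muln2 le_wbound // !expnS expn0; nia. Qed.
Lemma k_lt : k < 2 ^ k. Proof. exact: ltn_expl. Qed.
Lemma pow_le : 2 ^ k <= Y. Proof. by have := top_le; lia. Qed.
Lemma k_le : k <= Y. Proof. by have := k_lt; have := pow_le; lia. Qed.

Lemma cell_lt u v : u < n -> v < n -> u * n + v < n * n.
Proof. by move=> ltu ltv; have := leq_mul ltu (leqnn n); rewrite mulSn; lia. Qed.

Lemma cell_cap u v : u < n -> v < n -> u * n + v < cap n.
Proof. by move=> ltu ltv; have := cell_lt ltu ltv; rewrite /cap; lia. Qed.

Lemma cell_inj u v u' v' : v < n -> v' < n ->
  (u * n + v == u' * n + v') = (u == u') && (v == v').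
Proof.
move=> ltv ltv'; apply/eqP/andP => [E|[/eqP-> /eqP->//]].
have n0 : 0 < n by lia.
have Eu : u = u'.
  by move: (congr1 (divn^~ n) E); rewrite !divnMDl // !divn_small // !addn0.
by move: E; rewrite Eu => /addnI->; rewrite !eqxx.
Qed.

Lemma inok_param a : a < 4 -> inok n a.
Proof. by move=> lt; split=> [|i _]; lia. Qed.

Lemma inok_cell u v : u < n -> v < n -> u != v -> inok n (4 + (u * n + v)).
Proof.
move=> ltu ltv /eqP ne; split; first by rewrite ltn_add2l cell_lt.
move=> i _ /addnI; rewrite mulnS addnC => /eqP E.
have [lti|lei] := ltnP i n; last by have := cell_lt ltu ltv; nia.
by move: E; rewrite addnC [i + _]addnC cell_inj // => /andP[/eqP ? /eqP ?]; lia.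
Qed.

Lemma input_cell (u v : V) : inp (4 + (u * n + v)) = adjE (edges G) u v.
Proof.
rewrite /input /=; congr nat_of_bool; apply/existsP/idP => [[a /existsP[b]]|uv].
  by rewrite cell_inj // => /andP[/andP[/eqP/val_inj -> /eqP/val_inj ->]].
by exists u; apply/existsP; exists v; rewrite eqxx.
Qed.

Lemma inp_le a : inok n a -> inp a <= Y.
Proof.
move=> _; case: a => [|[|[|[|a]]]] /=; rewrite ?n_le ?g1_le ?g2_le ?k_le //.
by apply: leq_trans one_le; case: [exists _, _].
Qed.

Record base (s : state) : Prop := Base {
  base_sq : vars s rSq = n * n;
  base_n : vars s rN = n;
  base_k : vars s rK = k;
  base_p : vars s rP = 2 ^ k;
  base_g1 : vars s rG1 = g1;
  base_g2 : vars s rG2 = g2;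
  base_row : forall u, u < n -> arrs s aRow u = u * n
}.

(** Registers below 6 and the row table are final after the setup, so their preservation is decided
    by computing write sets. *)
Lemma base_same ws aw s s' : all (leq 6) ws -> all (leq 1) aw ->
  same ws aw s s' -> base s -> base s'.
Proof.
move=> lw la [SV SA] [b0 b1 b2 b3 b4 b5 br].
have nw z : z < 6 -> z \notin ws.
  by move=> lt; apply/negP=> /(allP lw); rewrite leqNgt lt.
have na : 0 \notin aw by apply/negP=> /(allP la).
by split; rewrite ?SV ?nw // => u ltu; rewrite SA // br.
Qed.

Lemma base_setv i x s : 5 < i -> base s -> base (setv i x s).
Proof.
move=> lti; apply: (@base_same [:: i] [::]); rewrite //= ?andbT //.
by split=> // z; rewrite inE /= => /negPf->.
Qed.

Lemma base_seta a i x s : 0 < a -> base s -> base (seta a i x s).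
Proof.
move=> lta; apply: (@base_same [::] [:: a]); rewrite //= ?andbT //.
by split=> // b; rewrite inE => /negPf nb j /=; rewrite nb.
Qed.

Record params (s : state) : Prop := Params {
  par_n : vars s rN = n;
  par_k : vars s rK = k;
  par_g1 : vars s rG1 = g1;
  par_g2 : vars s rG2 = g2;
  par_ans : vars s rAns = 0;
  par_best : arrs s aBest 0 = 0
}.

Definition state0 := State (fun _ => 0) (fun _ _ => 0).

Lemma wp_load : wp load_params (fun s => params s /\ vars s rSq = 0) state0.
Proof.
have oki a : a < 4 -> inok n a by exact: inok_param.
rewrite /load_params /=; split; [by split; [|exact: oki]|exact: n_le|].
split; [by split; [|exact: oki]|exact: g1_le|].
split; [by split; [|exact: oki]|exact: g2_le|].
by split; [by split; [|exact: oki]|exact: k_le|].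
Qed.

Lemma lim_n s : vars s rN = n -> vars s rN <= lim n k false.
Proof. by move=> ->; rewrite leqnSn. Qed.

Lemma wp_square s : params s -> vars s rSq = 0 ->
  wp make_square (fun s => params s /\ vars s rSq = n * n) s.
Proof.
move=> [p1 p2 p3 p4 p5 p6] s0.
apply: (@wp_for _ _ _ _ _ _ _ _ (fun j s' => vars s' rSq = j * n)); first exact: lim_n.
- by rewrite mul0n.
- move=> j s'; rewrite p1 => ltj Ij [SV SA] /=; rewrite (SV rN) // p1 Ij.
  by split=> //; [have := nn_le; nia | rewrite mulSn addnC].
move=> s'; rewrite p1 => Ij [SV SA]; split=> //.
by split=> /=; rewrite ?SV ?SA.
Qed.

Lemma wp_power s : params s -> vars s rSq = n * n ->
  wp make_power (fun s => [/\ params s, vars s rSq = n * n & vars s rP = 2 ^ k]) s.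
Proof.
move=> [p1 p2 p3 p4 p5 p6] s0; split=> //; first exact: one_le.
apply: (@wp_for _ _ _ _ _ _ _ _ (fun j s' => vars s' rP = 2 ^ j)).
- by rewrite /= p2 ltnW // k_lt.
- by [].
- move=> j s'; rewrite /= p2 => ltj Ij [SV SA] /=; rewrite Ij.
  split=> //; last by rewrite expnS mul2n addnn.
  apply: leq_trans pow_le; rewrite addnn -mul2n -expnS leq_exp2l //.
move=> s'; rewrite /= p2 => Ij [SV SA].
by split=> //; [split|]; rewrite /= ?SV ?SA.
Qed.

Lemma wp_rows s : params s -> vars s rSq = n * n -> vars s rP = 2 ^ k ->
  wp make_rows (fun s => [/\ base s, vars s rAns = 0 & arrs s aBest 0 = 0]) s.
Proof.
move=> [p1 p2 p3 p4 p5 p6] s0 sp; split=> //.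
apply: (@wp_for _ _ _ _ _ _ _ _ (fun j s' =>
  vars s' rT = j * n /\ forall u, u < j -> arrs s' aRow u = u * n)).
- exact: lim_n.
- by [].
- move=> j s' ltj [It Ir] [SV SA] /=; rewrite /= p1 in ltj.
  have lejn : j * n + n <= n * n by nia.
  split=> //.
  + by rewrite (SV rSq) //= s0 /cap; split=> //; lia.
  + by rewrite It; have := nn_le; lia.
  split=> //.
  + by rewrite It (SV rN) //= p1; have := nn_le; lia.
  rewrite It (SV rN) //= p1; split; first by rewrite mulSn addnC.
  move=> u; rewrite ltnS leq_eqVlt; case: eqP => [->//|_ /= ltu]; exact: Ir.
move=> s'; rewrite /= p1 => -[It Ir] [SV SA].
by split; [split|..]; rewrite /= ?SV ?SA.
Qed.

Lemma wp_product s a b : base s -> vars s rU = a -> vars s rV = b -> b <= a < n ->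
  wp make_product (fun s' => vars s' rW = 2 * (b.+1 * (a - b))) s.
Proof.
move=> bs va vb lt; split=> //.
apply: (@wp_for _ _ _ _ _ _ _ _ (fun j s' => vars s' rW = 2 * (minn j b.+1 * (a - b)))).
- by apply: lim_n; case: bs.
- by rewrite min0n.
- move=> j s' _ Ij [SV SA] /=; split=> //.
  rewrite (SV rV) //= vb (SV rU) //= va Ij; case: eqP => le.
    by rewrite (minn_idPr _) ?Ij ?(minn_idPr _) //; lia.
  split=> //; last by rewrite !(minn_idPl _); lia.
  rewrite (minn_idPl _); last by lia.
  have : j.+1 * (a - b) <= n * n by apply: leq_mul; lia.
  by have := nn2_le; rewrite mulSn; lia.
by move=> s' /= ->; case: bs => _ -> *; rewrite (minn_idPr _) //; lia.
Qed.

Lemma wp_best s : base s -> vars s rAns = 0 -> arrs s aBest 0 = 0 ->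
  wp make_best (fun s => [/\ base s, vars s rAns = 0
                          & best_table g1 g2 n top (arrs s aBest)]) s.
Proof.
move=> bs an d0.
apply: (@wp_for _ _ _ _ _ _ _ _ (fun j s' => best_table g1 g2 j top (arrs s' aBest))).
- by apply: lim_n; case: bs.
- by split=> // r; lia.
- move=> a s1; rewrite (base_n bs) => lta tb S1.
  have b1 : base s1 by apply: base_same S1 bs.
  split=> //; first by rewrite /= (base_p b1) top_le.
  set D := arrs s1 aBest in tb.
  (* The invariant is the clause of [best_table] for the entry a + 1, with the candidates in the
     minimum restricted to t <= i. The entries read from D are those of smaller index, already
     final. *)
  apply: wp_seq; apply: (@wp_for _ _ _ _ _ _ _ _ (fun i s2 => let m := vars s2 rI in
    [/\ m <= top,
        forall t, 0 < t <= i -> t <= a.+1 -> g1 <= t <= g2 ->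
          m <= D (a.+1 - t) + 2 * (t * (a.+1 - t))
      & m = top \/ exists t, [/\ 0 < t <= a.+1, g1 <= t <= g2
          & m = D (a.+1 - t) + 2 * (t * (a.+1 - t))]])).
  + by apply: lim_n; case: b1.
  + by rewrite /= (base_p b1); split; [|lia|left].
  + move=> b s2; rewrite /= (base_n b1) => ltb [I1 I2 I3] S2.
    set s2' := setv rV b s2.
    have b2 : base s2 by apply: base_same S2 _; do 2?apply: base_setv.
    have b2' : base s2' by apply: base_setv.
    have vU : vars s2 rU = a by rewrite S2.1.
    rewrite vU (base_g1 b2) (base_g2 b2); split=> //.
    case: eqP => [cond|ncond]; last first.
      split=> // t /andP[t0]; rewrite leq_eqVlt => /orP[/eqP -> le gg|lt]; first by lia.
      by apply: I2; rewrite t0.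
    have [le lg] : b <= a /\ g1 <= b.+1 <= g2 by lia.
    have pr := @wp_product s2' a b b2' vU erefl.
    have /pr/wp_frame pr' : b <= a < n by rewrite le.
    apply: wp_mono pr' => s3 [vW S3].
    have b3 : base s3 by apply: base_same S3 b2'.
    have [vU3 vV3 vI3] : [/\ vars s3 rU = a, vars s3 rV = b & vars s3 rI = vars s2 rI].
      by split; rewrite S3.1.
    have D3 x : arrs s3 aBest x = D x by rewrite S3.2 // S2.2.
    have okA : a - b < cap n by rewrite /cap; lia.
    rewrite /= vU3 vV3 vW D3 vI3.
    do 2?[split; first by rewrite (base_sq b3)].
    have E1 : a.+1 - b.+1 = a - b by lia.
    case: eqP => cmp.
      split=> // t /andP[t0]; rewrite leq_eqVlt => /orP[/eqP-> _ _|lt].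
        by rewrite E1; lia.
      by apply: I2; rewrite t0.
    split; [by rewrite (base_sq b3)| |split].
    * by have := top_le; lia.
    * lia.
    * move=> t /andP[t0]; rewrite leq_eqVlt => /orP[/eqP-> _ _|lt le' gg].
        by rewrite E1.
      by have := I2 t; rewrite t0 => /(_ lt le' gg); lia.
    by right; exists b.+1; rewrite E1; split=> //; lia.
  move=> s2; rewrite /= (base_n b1) => -[I1 I2 I3] S2.
  have b2 : base s2 by apply: base_same S2 _; do 2?apply: base_setv.
  have vU : vars s2 rU = a by rewrite S2.1.
  have D2 x : arrs s2 aBest x = D x by rewrite S2.2.
  rewrite vU; split=> //.
  + by rewrite (base_sq b2) /cap; split=> //; lia.
  + by have := top_le; lia.
  rewrite addn1; case: tb => D0 tb; split; first by rewrite /= D2.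
  move=> r /andP[r0]; rewrite leq_eqVlt => /orP[/eqP->|ltr].
    rewrite eqxx; split=> //.
      move=> t lt gg; rewrite D2; case: eqP => [|_]; first by lia.
      by apply: I2 => //; lia.
    case: I3 => [|[t [lt gg Et]]]; [by left|right; exists t].
    by rewrite D2; case: eqP; [lia|].
  have [|H1 H2 H3] := tb r; first by rewrite r0.
  rewrite /= (ltn_eqF ltr) D2; split=> //.
    by move=> t lt gg; rewrite ifF ?D2; [apply: H2|apply/eqP; lia].
  case: H3 => [|[t [lt gg Et]]]; [by left|right; exists t].
  by rewrite ifF ?D2 //; apply/eqP; lia.
move=> s1; rewrite (base_n bs) => tb S1; split=> //; last by rewrite /= S1.1.
by apply: base_setv => //; apply: base_same S1 bs.
Qed.

Definition matrix (E : {set {set V}}) s :=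
  forall u v : V, arrs s aMat (u * n + v) = adjE E u v.

Lemma cell_ok s i j (u v : V) : base s -> vars s i = u -> vars s j = v ->
  [/\ eok n inp s (cell i j), ev inp s (cell i j) = u * n + v,
      u * n + v < cap n & vars s rSq = n * n].
Proof.
move=> bs vu vv; have ltu := ltn_ord u; rewrite /= vu vv (base_row bs) //.
rewrite (base_sq bs) cell_cap //; split=> //; split=> //; split=> //.
by split=> //; rewrite /cap; lia.
Qed.

Lemma mat_ok s i j (u v : V) E : base s -> matrix E s ->
  vars s i = u -> vars s j = v ->
  eok n inp s (HA aMat (cell i j)) /\
  ev inp s (HA aMat (cell i j)) = adjE E u v.
Proof.
move=> bs mE vu vv; have [o e c sq] := cell_ok bs vu vv.
split; last by rewrite -[LHS]/(arrs s aMat (ev inp s (cell i j))) e mE.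
by split=> //; rewrite e.
Qed.

Lemma neq_ev s i j (u v : V) : vars s i = u -> vars s j = v ->
  (ev inp s (neq i j) == 0) = (u == v).
Proof. by move=> vu vv; rewrite /= vu vv -val_eqE /=; apply/eqP/eqP; lia. Qed.

Lemma wp_copy s : base s -> wp copy_matrix (matrix (edges G)) s.
Proof.
move=> bs; apply: (@wp_for _ _ _ _ _ _ _ _ (fun j s' => forall u v : V, u < j ->
  arrs s' aMat (u * n + v) = adjE (edges G) u v)).
- by apply: lim_n; case: bs.
- by [].
- move=> a s1; rewrite (base_n bs) => lta Ia S1; pose ua := Ordinal lta.
  have b1 : base (setv rU a s1) by apply: base_setv => //; apply: base_same S1 bs.
  apply: (@wp_for _ _ _ _ _ _ _ _ (fun j s' => forall u v : V,
    u < a \/ u = ua /\ v < j -> arrs s' aMat (u * n + v) = adjE (edges G) u v)).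
  + by apply: lim_n; case: b1.
  + by move=> u v [lt|[]//]; apply: Ia.
  + move=> b s2; rewrite (base_n b1) => ltb Ib S2; pose vb := Ordinal ltb.
    have b2 : base (setv rV b s2) by apply: base_setv => //; apply: base_same S2 b1.
    have vU : vars (setv rV b s2) rU = ua by rewrite /= S2.1.
    have vV : vars (setv rV b s2) rV = vb by [].
    have [o e c sq] := cell_ok b2 vU vV.
    have upd (u v : V) : u < a \/ u = ua /\ v < b.+1 ->
        arrs (seta aMat (ua * n + vb) (adjE (edges G) ua vb) (setv rV b s2)) aMat
          (u * n + v) = adjE (edges G) u v.
      move=> H; rewrite /= cell_inj // ?ltn_ord //.
      case: andP => [[/eqP eu /eqP ev]|ne].
        by congr (nat_of_bool (adjE _ _ _)); apply: val_inj.
      apply: Ib; case: H => [|[uu lt]]; [by left|right; split=> //].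
      rewrite ltn_neqAle -ltnS lt andbT; apply/eqP=> ev; apply: ne.
      by rewrite uu ev !eqxx.
    split=> //; rewrite (neq_ev vU vV); case: ifP => [/eqP uv|/negbT uv].
      split=> //; first by rewrite e.
      rewrite e; move: upd; rewrite -{2}uv adjE_irr //; exact: edges_simple.
    have in_ok : inok n (4 + (ua * n + vb)) by apply: inok_cell; rewrite ?ltn_ord.
    have ei : ev inp (setv rV b s2) (HIn (HC 4 |+| cell rU rV)) = adjE (edges G) ua vb.
      by rewrite -input_cell -e.
    split=> //.
    * by split=> //; rewrite -[ev _ _ _]/(4 + ev inp (setv rV b s2) (cell rU rV)) e.
    * by rewrite e.
    * by rewrite ei; apply: leq_trans one_le; case: adjE.
    by rewrite e ei.
  move=> s2; rewrite (base_n b1) => I2 _ u v; rewrite ltnS leq_eqVlt => /orP[/eqP eu|lt].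
    by apply: I2; right; split=> //; apply: val_inj.
  by apply: I2; left.
by move=> s1; rewrite (base_n bs) => I1 _ u v; apply: I1.
Qed.

(** A simulation rule: it lets [run_branch] be checked loop by loop against the functional model
    [branch]. The relation must ignore the counter, which the loop overwrites. *)
Lemma wp_foldl (T : Type) (R : T -> state -> Prop) (f : T -> V -> T) i c a s :
  vars s rN = n -> R a s ->
  (forall a s j, R a s -> R a (setv i j s)) ->
  (forall (u : V) a s, R a s -> vars s i = u -> wp c (R (f a u)) s) ->
  wp (HFor false i rN c) (R (foldl f a (enum V))) s.
Proof.
move=> vn Ra Rset Rf.
apply: (@wp_for _ _ _ _ _ _ _ _ (fun j s' => R (foldl f a (take j (enum V))) s')).
- exact: lim_n.
- by rewrite take0.
- move=> j s'; rewrite vn => ltj Rj _; pose u := Ordinal ltj.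
  have -> : take j.+1 (enum V) = rcons (take j (enum V)) u.
    by rewrite (take_nth u) ?size_enum_ord // (nth_ord_enum u u).
  by rewrite foldl_rcons; apply: Rf; [apply: Rset | rewrite /= eqxx].
by move=> s'; rewrite vn take_oversize ?size_enum_ord // => Rn _; apply: Rset.
Qed.

Lemma pair_eq (a b u v : V) :
  ([set a; b] == [set u; v]) = (a == u) && (b == v) || (a == v) && (b == u).
Proof.
apply/eqP/orP => [E|[]/andP[/eqP-> /eqP->]//]; last by rewrite setUC.
have /set2P Ea : a \in [set u; v] by rewrite -E set21.
have /set2P Eb : b \in [set u; v] by rewrite -E set22.
have /set2P Eu : u \in [set a; b] by rewrite E set21.
have /set2P Ev : v \in [set a; b] by rewrite E set22.
by case: Ea Eb Eu Ev => -> [] -> [] eu [] ev; rewrite ?eqxx -?eu -?ev ?eqxx; auto.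
Qed.

Lemma wp_remove s i j (u v : V) E : base s -> matrix E s ->
  vars s i = u -> vars s j = v ->
  wp (remove_edge i j) (fun s' => base s' /\ matrix (E :\ [set u; v]) s') s.
Proof.
move=> bs mE vu vv; have [o e c sq] := cell_ok bs vu vv.
split=> //; first by rewrite e.
rewrite e; set s1 := seta _ _ _ _; have b1 : base s1 by apply: base_seta.
have [o' e' c' sq'] := @cell_ok s1 j i v u b1 vv vu.
split=> //; first by rewrite e'.
rewrite e'; split; first exact: base_seta.
move=> a b; rewrite /= !cell_inj ?ltn_ord //.
rewrite /adjE !inE pair_eq -/(adjE E a b) mE.
rewrite -[val a == val v]/(a == v) -[val b == val u]/(b == u).
rewrite -[val a == val u]/(a == u) -[val b == val v]/(b == v).
by case: (a == u); case: (b == v); case: (a == v); case: (b == u).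
Qed.

Definition brel (a : {set {set V}} * nat * nat) s :=
  [/\ base s, matrix a.1.1 s, vars s rY = a.1.2, vars s rD = a.2 & binv k G a].

Lemma brel_setv a s i x : 9 < i -> brel a s -> brel a (setv i x s).
Proof.
move=> lt [? ? vy vd ?]; split=> //=; first by apply: base_setv => //; lia.
  by rewrite ifF //; apply/eqP; lia.
by rewrite ifF //; apply/eqP; lia.
Qed.

Lemma wp_step a s (u v w : V) : brel a s ->
  vars s rU = u -> vars s rV = v -> vars s rW = w ->
  wp branch_step (brel (step k a u v w)) s.
Proof.
case: a => [[E y] d] [bs mE vy vd inva] vu vv vw; rewrite /= in mE vy vd.
have inv' := step_inv u v w inva.
have skip : ~~ p3 E u v w -> brel (step k (E, y, d) u v w) s.
  by rewrite /step => /negPf->.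
have nat_b (b : bool) : (nat_of_bool b == 0) = ~~ b by case: b.
have [o e] := mat_ok bs mE vu vv; split=> //; rewrite e nat_b {o e}.
case: ifP => [/negPf uv|/negbFE uv]; first by apply: skip; rewrite /p3 uv.
have [o e] := mat_ok bs mE vv vw; split=> //; rewrite e nat_b {o e}.
case: ifP => [/negPf vw'|/negbFE vw']; first by apply: skip; rewrite /p3 vw' andbF.
split=> //; rewrite (neq_ev vu vw); case: ifP => [uw|/negbT uw].
  by apply: skip; rewrite /p3 uw !andbF.
have [o e] := mat_ok bs mE vu vw; split=> //; rewrite e nat_b {o e}.
case: ifP => [uw'|/negbFE uw']; last by apply: skip; rewrite /p3 uw' !andbF.
have P : p3 E u v w by rewrite /p3 uv vw' uw uw'.
move: inv'; rewrite /step P => inv' {skip}.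
have [_ lty _] := inva; rewrite /= in lty.
(* The counter d counts deleted edges, of which there are at most n^2. *)
have dY : d.+1 <= Y.
  have EG : #|edges G| <= n * n.
    have := handshake_le (@edges_simple _ G); rewrite card_ord mul2n -addnn.
    exact: leq_trans (leq_addr _ _).
  apply: leq_trans nn_le; apply: leq_trans EG.
  by move: inv'; case: ifP => _ [_ _ /= ->]; rewrite subset_leq_card // subsetDl.
have ey : ev inp s ($rY |+| $rY) = y + y by rewrite /= vy.
split=> //; rewrite ey; first by have := top_le; lia.
set s1 := setv _ _ _; have b1 : base s1 by apply: base_setv.
have e1 : ev inp s1 ($rP |-| $rY) = 2 ^ k - (y + y) by rewrite /= (base_p bs).
have finish s3 E' y' : base s3 -> matrix E' s3 -> vars s3 rY = y' -> vars s3 rD = d ->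
    binv k G (E', y', d.+1) -> wp (HSet rD ($rD |+| HC 1)) (brel (E', y', d.+1)) s3.
  move=> b3 m3 vy3 vd3 i3; split; rewrite //= vd3 addn1 //.
  by split=> //; apply: base_setv.
apply: wp_seq; split=> //; rewrite e1; case: eqP => le.
  have lt : 2 ^ k <= y + y by lia.
  rewrite lt in inv' *.
  have e2 : ev inp s1 ($rY |-| $rP) = y + y - 2 ^ k by rewrite /= (base_p bs).
  split=> //; rewrite e2; first by have := top_le; lia.
  set s2 := setv _ _ _; have b2 : base s2 by apply: base_setv.
  apply: wp_mono (wp_frame (wp_remove (i := rU) (j := rV) (u := u) (v := v) b2 mE vu vv)).
  by move=> s3 [[b3 m3] S3]; apply: finish; rewrite // S3.1.
have lt : (2 ^ k <= y + y) = false by lia.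
rewrite lt in inv' *.
apply: wp_mono (wp_frame (wp_remove (i := rV) (j := rW) (u := v) (v := w) b1 mE vv vw)).
by move=> s3 [[b3 m3] S3]; apply: finish; rewrite // S3.1.
Qed.

Lemma wp_branch a s : brel a s -> wp run_branch (brel (branch k a)) s.
Proof.
move=> Ra; have Rn a' s' : brel a' s' -> vars s' rN = n by case=> -[].
apply: wp_foldl => // [|{}Ra|]; [exact: Rn Ra|by move=> *; apply: brel_setv|].
move=> _ {}a {}s {}Ra _.
apply: wp_foldl => //; [exact: Rn Ra|by move=> *; apply: brel_setv|].
move=> _ {}a {}s {}Ra _.
apply: wp_foldl => //; [exact: Rn Ra|by move=> *; apply: brel_setv|].
move=> u {}a {}s {}Ra vu.
(* The innermost body reads all three counters, so the relation has to remember the outer ones. *)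
pose R1 a s := brel a s /\ vars s rU = u.
suff: wp (HFor false rV rN (HFor false rW rN branch_step))
    (R1 (foldl (fun a v => foldl (fun a w => step k a u v w) a (enum V)) a (enum V))) s.
  by apply: wp_mono => s' [].
apply: wp_foldl => //; [exact: Rn Ra|by move=> ? ? ? [? ?]; split=> //; apply: brel_setv|].
move=> v {Ra vu}a {}s [Ra vu] vv.
pose R2 a s := R1 a s /\ vars s rV = v.
suff: wp (HFor false rW rN branch_step)
    (R2 (foldl (fun a w => step k a u v w) a (enum V))) s.
  by apply: wp_mono => s' [].
apply: wp_foldl => //; [exact: Rn Ra| |].
  by move=> ? ? ? [[? ?] ?]; split=> //; split=> //; apply: brel_setv.
move=> w {Ra vu vv}a {}s [[Ra vu] vv] vw.
apply: wp_mono (wp_frame (wp_step Ra vu vv vw)) => s' [R' S'].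
by split; [split=> //|]; rewrite S'.1.
Qed.

Lemma sum_ltS (P : pred V) (F : V -> nat) (u : V) :
  \sum_(v | P v && (v < u.+1)) F v = \sum_(v | P v && (v < u)) F v + P u * F u.
Proof.
rewrite (bigID (pred1 u)) /= addnC; congr (_ + _).
  apply: eq_bigl => v; rewrite ltnS -andbA; congr (_ && _).
  by rewrite ltn_neqAle andbC.
case Pu: (P u); last first.
  by rewrite big_pred0 // => v; case: eqP => [->|]; rewrite ?Pu ?andbF.
rewrite mul1n (big_pred1 u) // => v /=; case: eqP => [->|]; rewrite ?andbF //.
by rewrite Pu ltnSn.
Qed.

Lemma sum_lt0 (P : pred V) (F : V -> nat) : \sum_(v | P v && (v < 0)) F v = 0.
Proof. by rewrite big_pred0 // => v; rewrite andbF. Qed.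

Lemma sum_ltn (P : pred V) (F : V -> nat) :
  \sum_(v | P v && (v < n)) F v = \sum_(v | P v) F v.
Proof. by apply: eq_bigl => v; rewrite ltn_ord andbT. Qed.

Lemma wp_count s E (u : V) : base s -> matrix E s -> simple E -> vars s rU = u ->
  wp count_neighbours
    (fun s' => vars s' rJ = #|class E u| /\ (vars s' rT == 0) = isrep E u) s.
Proof.
move=> bs mE sE vu; split=> //; first exact: one_le.
split=> //; set s0 := setv rT _ _; have b0 : base s0 by do 2!apply: base_setv => //.
pose small v := adjE E u v && (v < u).
apply: (@wp_for _ _ _ _ _ _ _ _ (fun j s' =>
  [/\ vars s' rJ = 1 + \sum_(v | adjE E u v && (v < j)) 1, vars s' rJ <= j.+1,
      vars s' rT = \sum_(v | small v && (v < j)) 1 & vars s' rT <= j])).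
- by apply: lim_n; case: b0.
- by rewrite !sum_lt0.
- move=> j s1; rewrite (base_n b0) => ltj [I1 I2 I3 I4] S1.
  pose v := Ordinal ltj; set s2 := setv rV j s1.
  have b2 : base s2 by apply: base_setv => //; apply: base_same S1 b0.
  have m2 : matrix E s2 by move=> a b; rewrite /= S1.2 //= mE.
  have vu2 : vars s2 rU = u by rewrite /= S1.1.
  have [o e] := @mat_ok s2 rU rV u v E b2 m2 vu2 erefl; split=> //; rewrite e {o e}.
  have n1 := n1_le.
  have SJ := sum_ltS (adjE E u) (fun=> 1) v; have ST := sum_ltS small (fun=> 1) v.
  rewrite -[nat_of_ord v]/j !muln1 in SJ ST.
  case uv: (adjE E u v); last first.
    by rewrite SJ ST /small uv !addn0 -I1 -I3; split=> //=; lia.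
  have eJ : ev inp s2 ($rJ |+| HC 1) = (vars s1 rJ).+1 by rewrite /= addn1.
  split=> //; rewrite eJ; first by lia.
  split=> //; set s3 := setv rJ _ _.
  have -> : ev inp s3 ($rU |-| $rV) = u - j.
    by rewrite -[LHS]/(vars s2 rU - j) vu2.
  case: eqP => le.
    have nsm : small v = false.
      by rewrite /small uv /=; apply/negbTE; rewrite -leqNgt -subn_eq0 le.
    by rewrite SJ ST uv nsm addn0 addnA -I1 -I3 addn1; split=> //=; lia.
  have sm : small v by rewrite /small uv /=; lia.
  have eT : ev inp s3 ($rT |+| HC 1) = (vars s1 rT).+1 by rewrite /= addn1.
  split=> //; rewrite eT; first by lia.
  by rewrite SJ ST uv sm addnA -I1 -I3 !addn1; split.
move=> s1; rewrite (base_n b0) => -[I1 _ I3 _] S1; rewrite /= I1 I3 !sum_ltn.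
rewrite !sum1dep_card; split.
  rewrite (cardsD1 u (class E u)) class_refl; congr (_ + _); apply: eq_card => v.
  by rewrite !inE; case: eqP => // ->; rewrite adjE_irr.
rewrite cards_eq0; apply/eqP/forallP => [E0 v|H].
  apply/implyP=> lt; apply/negP=> uv; have := in_set0 v.
  by rewrite -E0 inE /small uv lt.
apply/setP=> v; rewrite !inE /small; apply/negbTE; rewrite negb_and orbC.
by have := H v; case: (v < u).
Qed.

Lemma best_table_le m (D : nat -> nat) t : best_table g1 g2 m top D -> t <= m -> D t <= top.
Proof.
case=> D0 DS le; case: t le => [|t] le; first by rewrite D0.
by case: (DS t.+1).
Qed.

Lemma wp_sum s E : base s -> matrix E s -> simple E ->
  best_table g1 g2 n top (arrs s aBest) ->
  wp sum_best
    (fun s' => vars s' rI = \sum_(r | isrep E r) arrs s aBest #|class E r|) s.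
Proof.
move=> bs mE sE tb; set D := arrs s aBest in tb *; split=> //.
set s0 := setv rI _ _; have b0 : base s0 by apply: base_setv.
(* The second conjunct excludes overflow: each summand is at most [top]. *)
apply: (@wp_for _ _ _ _ _ _ _ _ (fun j s' =>
  vars s' rI = \sum_(r | isrep E r && (r < j)) D #|class E r| /\
  vars s' rI <= j * top)).
- by apply: lim_n; case: b0.
- by rewrite sum_lt0.
- move=> j s1; rewrite (base_n b0) => ltj [I1 I2] S1; pose u := Ordinal ltj.
  set s2 := setv rU j s1.
  have b2 : base s2 by apply: base_setv => //; apply: base_same S1 b0.
  have m2 : matrix E s2 by move=> a b; rewrite /= S1.2 //= mE.
  apply: wp_seq; apply: wp_mono (wp_frame (@wp_count s2 E u b2 m2 sE erefl)).
  move=> s3 [[vJ vT] S3]; have b3 : base s3 by apply: base_same S3 b2.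
  have vI : vars s3 rI = vars s1 rI by rewrite S3.1.
  have SI := sum_ltS (isrep E) (fun r => D #|class E r|) u; rewrite -[nat_of_ord u]/j in SI.
  split=> //; rewrite -[ev _ _ _]/(vars s3 rT) vT.
  case: ifP => ru; last first.
    by split; rewrite vI ?SI ?ru ?addn0 //; lia.
  have cn := card_classN E u.
  have eI : ev inp s3 ($rI |+| HA aBest $rJ) = vars s1 rI + D #|class E u|.
    by rewrite /= vI vJ S3.2 // /s2 /= S1.2.
  have le : vars s1 rI + D #|class E u| <= j.+1 * top.
    by rewrite mulSn addnC leq_add // (best_table_le tb).
  split; rewrite ?eI.
  + by rewrite /= vJ (base_sq b3); split=> //; split=> //; split=> //; rewrite /cap; lia.
  + by apply: leq_trans le _; apply: leq_trans ntop_le; rewrite leq_mul2r ltj orbT.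
  by rewrite /= SI ru mul1n I1; split=> //; rewrite -I1.
by move=> s1; rewrite (base_n b0) => -[I1 _] _; rewrite /= I1 sum_ltn.
Qed.

Definition accepts D x := leaf_cost D (branch k (edges G, x, 0)) <= k + k.

Lemma wp_leaf s x b : base s -> best_table g1 g2 n top (arrs s aBest) ->
  x < 2 ^ k -> vars s rX = x -> vars s rAns = nat_of_bool b ->
  wp try_leaf (fun s' => base s' /\
    vars s' rAns = nat_of_bool (b || accepts (arrs s aBest) x)) s.
Proof.
move=> bs tb ltx vx va; have ex : ev inp s $rX = x by [].
split=> //; rewrite ex; first by apply: leq_trans pow_le; apply: ltnW.
split=> //; set s1 := setv rD _ _.
have b1 : base s1 by do 2!apply: base_setv => //.
apply: wp_seq; apply: wp_mono (wp_frame (wp_copy b1)) => s2 [m2 S2].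
have b2 : base s2 by apply: base_same S2 b1.
have i0 : binv k G (edges G, x, 0) by split; rewrite //= setDv cards0.
have R2 : brel (edges G, x, 0) s2 by split; rewrite // S2.1.
apply: wp_seq; apply: wp_mono (wp_frame (wp_branch R2)) => s3 [R3 S3].
rewrite /accepts /leaf_cost.
case: (branch k (edges G, x, 0)) R3 => [[E y] d] [b3 m3 _ vd3 [EG _ dE]].
rewrite /= in m3 vd3 EG dE.
have sE := simpleS EG (@edges_simple _ G).
have D3 t : arrs s3 aBest t = arrs s aBest t by rewrite S3.2 // S2.2.
have tb3 := eq_best_table (fsym D3) tb.
apply: wp_seq; apply: wp_mono (wp_frame (wp_sum b3 m3 sE tb3)) => s4 [vI S4].
have b4 : base s4 by apply: base_same S4 b3.
have vd4 : vars s4 rD = d by rewrite S4.1.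
have va4 : vars s4 rAns = b by rewrite S4.1 // S3.1 // S2.1.
have e4 : ev inp s4 ($rI |+| ($rD |+| $rD) |-| ($rK |+| $rK)) =
    \sum_(r | isrep E r) arrs s aBest #|class E r| + (d + d) - (k + k).
  rewrite /= vI vd4 (base_k b4); congr (_ + _ - _).
  by apply: eq_bigr => r _; rewrite D3.
split=> //; rewrite e4 subn_eq0 /=; case: ifP => acc.
  by split=> //; [exact: one_le | split; [exact: base_setv | rewrite acc orbT]].
by split; rewrite // acc orbF.
Qed.

Lemma wp_solver :
  wp solver (fun s => vars s rAns = CCClusterDeletion G g1 g2 k) state0.
Proof.
apply: wp_seq; apply: wp_mono wp_load => s1 [p1 q1].
apply: wp_seq; apply: wp_mono (wp_square p1 q1) => s2 [p2 q2].
apply: wp_seq; apply: wp_mono (wp_power p2 q2) => s3 [p3' q3 r3].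
apply: wp_seq; apply: wp_mono (wp_rows p3' q3 r3) => s4 [b4 a4 d4].
apply: wp_seq; apply: wp_mono (wp_best b4 a4 d4) => s5 [b5 a5 tb].
set D := arrs s5 aBest in tb.
apply: (@wp_for _ _ _ _ _ _ _ _ (fun j s' =>
  base s' /\ vars s' rAns = has (accepts D) (iota 0 j))).
- by rewrite (base_p b5).
- by [].
- move=> j s6; rewrite (base_p b5) => ltj [b6 a6] S6.
  have b6' : base (setv rX j s6) by apply: base_setv.
  have tb6 : best_table g1 g2 n top (arrs (setv rX j s6) aBest).
    by apply: eq_best_table tb => t; rewrite /= S6.2.
  apply: wp_mono (wp_leaf b6' tb6 ltj erefl a6) => s7 [b7 ->]; split=> //.
  rewrite -[j.+1]addn1 iotaD has_cat /= orbF add0n; congr (nat_of_bool (_ || (_ <= _))).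
  by congr (_ + _); apply: eq_bigr => r _; rewrite /= S6.2.
move=> s6; rewrite (base_p b5) => -[_ a6] _; rewrite /= a6; congr nat_of_bool.
apply/hasP/idP => [[x]|].
  rewrite mem_iota => ltx acc; apply/(branch_decides G tb); exists x => //.
by move/(branch_decides G tb) => [x ltx acc]; exists x; rewrite ?mem_iota.
Qed.

Lemma rep_input : rep n wbound inp state0 inp.
Proof.
split=> //= [i lti|a i lta lti].
  rewrite /input /=.
  apply/eqP; rewrite eqb0; apply/existsP=> -[u /existsP[v /andP[/eqP E uv]]].
  have := ltn_ord u; have := ltn_ord v => ltv ltu.
  have [ltn|len] := ltnP i n; last by have := cell_lt ltu ltv; nia.
  have: i * n + i == u * n + v by rewrite -E mulnS addnC.
  rewrite cell_inj // => /andP[/eqP iu /eqP iv].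
  have vu : v = u by apply: val_inj; rewrite /= -iv.
  by move: uv; rewrite vu -[adj _ _ _]/(adjE (edges G) u u) adjE_irr //; apply: edges_simple.
rewrite /input /=.
apply/eqP; rewrite eqb0; apply/existsP=> -[u /existsP[v /andP[/eqP E uv]]].
by have := cell_lt (ltn_ord u) (ltn_ord v); move: E; rewrite mulSn /cap; lia.
Qed.
End Solver.

Theorem mainTheorem13 :
  exists (P : cmd) (c : nat),
    forall (n g1 g2 k : nat) (G : graph 'I_n),
      answers P (2 ^ k * (n + g1 + g2 + 2) ^ c) (c * 2 ^ k * (n + 1) ^ c)
        (input G g1 g2 k) (CCClusterDeletion G g1 g2 k).
Proof.
(* Every address is computed from the n in cell 0, so the answer may overwrite it only at the very
   end. *)
pose last := Store (Const 0) (Deref (regE rAns)).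
(* One constant serves three purposes: time factor ([tconst solver] plus the final store), exponent
   of n + 1 ([ndepth solver]) and exponent of the word size (9). *)
pose c0 := tconst solver + (cost (Deref (regE rAns))).+2 + ndepth solver + 9.
exists (Seq (compile solver) last), c0 => n g1 g2 k G.
set B := n + g1 + g2 + 2; set W := 2 ^ k * B ^ c0.
have B2 : 2 <= B by rewrite /B addn2.
have k0 : 0 < 2 ^ k by rewrite expn_gt0.
have Wge : 2 ^ k * B ^ 9 <= W.
  by rewrite leq_mul2l leq_pexp2l ?orbT ?leq_addl //; lia.
(* The exponent 9 is 3 + 6: the cube is that of [wbound], and 2^6 = 64 pays for [maxwt] and the
   successor, as 30(Y + 1) <= 60Y. *)
have B3 : B ^ 3 * 64 <= B ^ 9.
  by rewrite -[9]/(3 + 6) expnD leq_mul2l (@leq_exp2r 2 B 6) ?B2 ?orbT.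
have W1 : maxwt * (wbound n g1 g2 k).+1 <= W.
  apply: leq_trans Wge; rewrite /wbound -/B /maxwt.
  apply: leq_trans (leq_mul (leqnn (2 ^ k)) B3); rewrite mulnA.
  have : 0 < 2 ^ k * B ^ 3 by rewrite muln_gt0 k0 expn_gt0 ltnW.
  lia.
have W2 : 4 + nreg * n.+1 + 4 * cap n <= W.
  apply: leq_trans Wge; apply: leq_trans (leq_pmull _ k0).
  apply: leq_trans B3; rewrite /cap /nreg !expnS expn0; rewrite /B; nia.
have [t [M' [s' [ex le r _ a]]]] := compile_sound erefl (@inp_le n g1 g2 k G) W1 W2
  solver_wf (@wp_solver n g1 g2 k G) (rep_input g1 g2 k G).
have X := exec_store (yields_const M' (leq0n W)) (yields_var erefl W1 W2 r (isT : rAns < nreg)).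
exists (t + (cost (Const 0) + cost (Deref (regE rAns))).+1), (update M' 0 (vars s' rAns)).
split; [exact: ExecSeq ex X | | by rewrite /update /= a].
have X0 : 0 < 2 ^ k * (n + 1) ^ c0 by rewrite muln_gt0 k0 expn_gt0 addn1.
have tb : t <= tconst solver * (2 ^ k * (n + 1) ^ c0).
  apply: leq_trans le _; apply: leq_trans (tbound_poly n k solver) _.
  (* The two loops that are bounded by 2^k are consecutive, not nested. *)
  have -> : kdepth solver = 1 by [].
  rewrite expn1 [X in _ * X <= _]mulnC addn1.
  have lec : ndepth solver <= c0 := leq_trans (leq_addl _ _) (leq_addr _ _).
  exact: leq_mul (leqnn _) (leq_mul (leqnn _) (leq_pexp2l (ltn0Sn n) lec)).
rewrite -mulnA; apply: leq_trans (leq_add tb (leq_pmulr _ X0)) _.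
rewrite -mulnDl; apply: leq_mul (leqnn _); rewrite /c0 -!addnA leq_add2l.
exact: leq_addr.
Qed.
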